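(* Let $H_1=\begin{bmatrix} f_1&u_1\\ g_1&v_1\end{bmatrix}$ and $H_2=\begin{bmatrix} f_2&u_2\\ g_2&v_2\end{bmatrix}$ be $2\times 2$ matrices with entries in $L^\infty$. The following statements are equivalent. (1) The product $R_{H_1}R_{H_2}$ is a generalized Cauchy singular integral operator, i.e. $R_{H_1}R_{H_2}=R_{H_3}$ for some $2\times 2$ matrix $H_3$ with entries in $L^\infty$. (2) The following equality of operators on $L^2\oplus L^2$ holds: $$\begin{bmatrix} V(\bar f_1)_-\\ (g_1)_-\end{bmatrix}\otimes\begin{bmatrix} V(f_2)_-\\ (\bar u_2)_-\end{bmatrix}=\begin{bmatrix} V(\bar u_1)_-\\ (v_1)_-\end{bmatrix}\otimes\begin{bmatrix} V(g_2)_-\\ (\bar v_2)_-\end{bmatrix}.$$ (3) One of the following conditions holds: (3.1) either $\bar f_1,g_1\in H^\infty$ or $f_2,\bar u_2\in H^\infty$; and either $\bar u_1,v_1\in H^\infty$ or $g_2,\bar v_2\in H^\infty$; (3.2) (in case (3.1) does not hold) there exists a nonzero constant $\lambda$ such that $\bar f_1-\bar\lambda\bar u_1,\ g_1-\lambda v_1,\ g_2-\lambda f_2,\ \bar v_2-\bar\lambda\bar u_2\in H^\infty$.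
   Context: $L^2$ and $L^\infty$ are the Lebesgue spaces of the unit circle $\mathbb T$ with normalized Lebesgue measure. $H^2\subset L^2$ is the Hardy space (functions whose negative Fourier coefficients vanish), $P_+$ is the orthogonal projection of $L^2$ onto $H^2$, $P_-=I-P_+$, and $H^\infty=L^\infty\cap H^2$. A bar denotes complex conjugation. For $x\in L^2$, $x_-=P_-x$. $V$ is the anti-unitary operator on $L^2$ given by $Vx=\bar z\bar x$; $V(x)_-$ means $V(P_-x)$. For vectors $p,q$ in a Hilbert space, $p\otimes q$ is the operator $x\mapsto\langle x,q\rangle p$; columns $\begin{bmatrix} x\\ y\end{bmatrix}$ with $x,y\in L^2$ are vectors of $L^2\oplus L^2$. For $H=\begin{bmatrix} f&u\\ g&v\end{bmatrix}$ with entries in $L^\infty$, the generalized Cauchy singular integral operator (GSIO) with symbol $H$ is the operator on $L^2$ given by $R_Hx=P_+fP_+x+P_-gP_+x+P_+uP_-x+P_-vP_-x$. *)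

(* Defs.v *)
From HB Require Import structures.
From mathcomp Require Import all_boot all_order all_algebra.
From mathcomp Require Import complex.
From mathcomp Require Import all_classical all_reals all_analysis.

Set Implicit Arguments.
Unset Strict Implicit.
Unset Printing Implicit Defensive.
Import Order.TTheory GRing.Theory Num.Theory.
Import numFieldNormedType.Exports.

Local Open Scope classical_set_scope.
Local Open Scope complex_scope.
Local Open Scope ring_scope.

Record circle (R : realType) :=
  Circle { circle_val :> R[i]; _ : `|circle_val| == 1 }.

HB.instance Definition _ (R : realType) := [isSub for @circle_val R].
HB.instance Definition _ (R : realType) := [Choice of circle R by <:].

Section circle_measure.
Variable R : realType.

Lemma cis_subproof (t : R) :
  `|cos (2 * pi * t) +i* sin (2 * pi * t)| == 1.
Proof. by rewrite normc_def /= cos2Dsin2 sqrtr1. Qed.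

Definition cis (t : R) : circle R := Circle (cis_subproof t).

HB.instance Definition _ := isPointed.Build (circle R) (cis 0).

(* The final sigma-algebra along t |-> e^(2 pi i t). The restriction of this
   map to [0, 1[ is a Borel isomorphism onto the circle, so these are exactly
   the Borel subsets of the circle. *)
Definition circle_measurable : set (set (circle R)) :=
  image_set_system [set: measurableTypeR R] cis measurable.

Let circle_sigma_algebra : sigma_algebra [set: circle R] circle_measurable.
Proof. exact/sigma_algebra_image/sigma_algebra_measurable. Qed.

Let circle_measurable0 : circle_measurable set0.
Proof. by case: circle_sigma_algebra. Qed.

Let circle_measurableC A : circle_measurable A -> circle_measurable (~` A).
Proof. by case: circle_sigma_algebra => _ mC _ /mC; rewrite setTD. Qed.

Let circle_measurable_bigcup (F : (set (circle R))^nat) :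
  (forall n, circle_measurable (F n)) -> circle_measurable (\bigcup_n F n).
Proof. by case: circle_sigma_algebra => _ _; exact. Qed.

HB.instance Definition _ := @isMeasurable.Build default_measure_display
  (circle R) circle_measurable circle_measurable0 circle_measurableC
  circle_measurable_bigcup.

Let measurable_cis : measurable_fun [set: measurableTypeR R] cis.
Proof. by []. Qed.

(* Normalized Lebesgue measure: the image of the uniform probability on [0, 1]
   under t |-> e^(2 pi i t). *)
Definition circle_measure : set (circle R) -> \bar R :=
  pushforward (uniform_prob (@ltr01 R)) cis.

Let circle_measure0 : circle_measure set0 = 0%E.
Proof. by rewrite /circle_measure /pushforward preimage_set0 measure0. Qed.

Let circle_measure_ge0 A : (0 <= circle_measure A)%E.
Proof. exact: measure_ge0. Qed.

Let circle_measure_sigma_additive : semi_sigma_additive circle_measure.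
Proof.
move=> F mF tF mUF.
exact: (@measure_semi_sigma_additive _ _ _
  (pushforward (uniform_prob (@ltr01 R)) cis)) tF mUF.
Qed.

HB.instance Definition _ := isMeasure.Build _ _ _ circle_measure
  circle_measure0 circle_measure_ge0 circle_measure_sigma_additive.

Let circle_measure_setT : circle_measure [set: circle R] = 1%E.
Proof.
by rewrite /circle_measure /pushforward preimage_setT probability_setT.
Qed.

HB.instance Definition _ := Measure_isProbability.Build _ _ _ circle_measure
  circle_measure_setT.

End circle_measure.

Section Hardy.
Variable R : realType.
Local Notation T := (circle R).
Local Notation C := R[i].
Local Notation mu := (@circle_measure R).
Implicit Types (f g h x y : T -> C).

(* Elements of L^p are represented by functions T -> C; equality in L^p is
   equality almost everywhere. *)
Definition Lp (p : \bar R) : set (T -> C) := [set f : T -> C |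
  [/\ measurable_fun [set: T] (fun z => complex.Re (f z)),
      measurable_fun [set: T] (fun z => complex.Im (f z)) &
      finite_norm mu p (fun z => Normc.normc (f z))]].

Definition L2 : set (T -> C) := Lp 2%:E.
Definition Linfty : set (T -> C) := Lp +oo%E.

Definition cintegral f : C :=
  (\int[mu]_z complex.Re (f z)) +i* (\int[mu]_z complex.Im (f z)).

Definition conjf f : T -> C := fun z => (f z)^*.

Definition inner f g : C := cintegral (f \* conjf g).

Definition fourier_coef f (n : int) : C :=
  cintegral (fun z => f z * (z : C) ^ (- n)).

Definition H2 : set (T -> C) :=
  [set f : T -> C | L2 f /\ forall n : int, n < 0 -> fourier_coef f n = 0].

Definition Hinfty : set (T -> C) := Linfty `&` H2.

(* The orthogonal projection of L^2 onto H^2: a representative of the (a.e.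
   unique) element y of H^2 such that x - y is orthogonal to H^2. *)
Definition Pplus x : T -> C :=
  xget (fun=> 0)
    [set y : T -> C | H2 y /\ forall h, H2 h -> inner (x \- y) h = 0].

Definition Pminus x : T -> C := x \- Pplus x.

Definition Vop x : T -> C := fun z => (z : C)^* * (x z)^*.

(* The arguments are the entries of the symbol, row by row. *)
Definition GSIO f u g v x : T -> C :=
  Pplus (f \* Pplus x) \+ Pminus (g \* Pplus x)
  \+ Pplus (u \* Pminus x) \+ Pminus (v \* Pminus x).

Definition eq_L2op (A B : (T -> C) -> T -> C) :=
  forall x, L2 x -> A x = B x %[ae mu].

Local Notation L2L2vec := ((T -> C) * (T -> C))%type.

Definition inner2 (p q : L2L2vec) : C :=
  inner p.1 q.1 + inner p.2 q.2.

Definition tensor2 (p q x : L2L2vec) : L2L2vec :=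
  let c := inner2 x q in
  (fun z => c * p.1 z, fun z => c * p.2 z).

Definition eq_L2L2op (A B : L2L2vec -> L2L2vec) :=
  forall x : L2L2vec, L2 x.1 -> L2 x.2 ->
    (A x).1 = (B x).1 %[ae mu] /\ (A x).2 = (B x).2 %[ae mu].

End Hardy.

(* Main.v *)
Require Import Defs.
From HB Require Import structures.
From mathcomp Require Import all_boot all_order all_algebra.
From mathcomp Require Import complex.
From mathcomp Require Import ring lra zify.
From mathcomp Require Import all_classical all_reals all_analysis.
From mathcomp Require Import measurable_realfun ess_sup_inf.

Set Implicit Arguments.
Unset Strict Implicit.
Unset Printing Implicit Defensive.
Import Order.TTheory GRing.Theory Num.Theory.
Import numFieldNormedType.Exports.

Local Open Scope classical_set_scope.
Local Open Scope complex_scope.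
Local Open Scope ring_scope.

(** Let [P] and [Q] be the projections of L2 onto H2 and onto its
    orthocomplement. Put
      [a = f2 P x + u2 Q x],  [b = conj f1 P w + conj g1 Q w],
      [a' = g2 P x + v2 Q x], [b' = conj u1 P w + conj v1 Q w].
    The two parts of the image of [x] under the right factor are [P a] and
    [Q a'], so the product of the two operators is described by
      [<R_H1 R_H2 x, w> = <P a, b> + <Q a', b'>]          ([inner_GSIO_comp]),
    whereas a single operator [R_H] is described by
      [<R_H x, w> = <f P x + u Q x, P w> + <g P x + v Q x, Q w>].

    Necessity of the rank-one identity. Let [x] and [w] have zero constant
    coefficient, so that [P] and [Q] commute with [z^-1] on them. Then the form
    of a single operator does not change when both [x] and [w] are multiplied
    by [z^-1]. The form of the product does change, because
      [<P (z^-1 a), z^-1 b> = <P a, b> - a_0 conj b_0],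
      [<Q (z^-1 a'), z^-1 b'> = <Q a', b'> + a'_0 conj b'_0],
    with the constant coefficients on the right
    ([inner_Pplus_shift], [inner_Pminus_shift]). If the product is a single
    operator, then [a_0 conj b_0 = a'_0 conj b'_0] for all such [x] and [w].
    Writing [x = z P x1 + Q x2], the functional [a_0] of [x1] and [x2] is the
    inner product with the column of [V (f2)_-] and [(conj u2)_-]
    ([inner2_symbol_vector]), and similarly for the other three. Hence the last
    equation is the equality of the two tensors ([tensor2_rank_one]).

    From the rank-one identity to the conditions on the symbols. The
    functional of [phi P x + psi Q x] vanishes if and only if [phi] and
    [conj psi] are in Hinfty ([functional_eq0P]). If one side of the identity
    vanishes then so does the other, and on each side one of the two factors is
    zero; otherwise the corresponding functionals are proportional, and their
    ratio is the constant [lambda] ([rank_one_dichotomy]).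

    Sufficiency. If on each side one pair of symbols is in Hinfty, then both
    [<P a, b>] and [<Q a', b'>] lose their projections. If the symbols are
    coupled by [lambda], then the part of [<P a, b>] that does not, namely
    [lambda <P a, b'>], cancels against a part of [<Q a', b'>]. What remains is
    the form of a single operator with explicit bounded symbols
    ([split_product_form], [coupled_product_form]).

    Two theorems of analysis support this. The projection onto H2 exists because
    L2 is complete ([riesz_fischer], [H2_projection_exists]). A function in L2
    whose Fourier coefficients all vanish is zero ([fourier_null_ae]); therefore
    the orthocomplement of H2 consists of the functions without nonnegative
    coefficients ([H2perp_of_fourier_coef]), multiplication by Hinfty preserves
    H2, and [V] exchanges H2 and its orthocomplement. *)

(** * Complex numbers and complex integrals *)

Section ComplexNumbers.
Variable R : realType.
Local Notation C := R[i].
Local Notation Re := (@complex.Re R).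
Local Notation Im := (@complex.Im R).
Implicit Types a b : C.

Definition normsq a : R := Re a ^+ 2 + Im a ^+ 2.

Lemma complex_eq a b : Re a = Re b -> Im a = Im b -> a = b.
Proof. by case: a b => [? ?] [? ?] /= -> ->. Qed.

Lemma ReD a b : Re (a + b) = Re a + Re b. Proof. by case: a; case: b. Qed.
Lemma ImD a b : Im (a + b) = Im a + Im b. Proof. by case: a; case: b. Qed.
Lemma ReN a : Re (- a) = - Re a. Proof. by case: a. Qed.
Lemma ImN a : Im (- a) = - Im a. Proof. by case: a. Qed.
Lemma ReM a b : Re (a * b) = Re a * Re b - Im a * Im b.
Proof. by case: a; case: b. Qed.
Lemma ImM a b : Im (a * b) = Re a * Im b + Im a * Re b.
Proof. by case: a; case: b. Qed.
Lemma ReJ a : Re a^* = Re a. Proof. by case: a. Qed.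
Lemma ImJ a : Im a^* = - Im a. Proof. by case: a. Qed.
Lemma conjcD a b : (a + b)^* = a^* + b^*. Proof. exact: rmorphD. Qed.
Lemma conjcN a : (- a)^* = - a^*. Proof. exact: rmorphN. Qed.
Lemma conjcM a b : (a * b)^* = a^* * b^*. Proof. exact: rmorphM. Qed.

Lemma normsq_ge0 a : 0 <= normsq a.
Proof. by rewrite addr_ge0 ?sqr_ge0. Qed.

Lemma normsqM a b : normsq (a * b) = normsq a * normsq b.
Proof. rewrite /normsq ReM ImM; ring. Qed.

Lemma normsqJ a : normsq a^* = normsq a.
Proof. by rewrite /normsq ReJ ImJ sqrrN. Qed.

Lemma normsq_eq0 a : normsq a = 0 -> a = 0.
Proof.
move/eqP; rewrite /normsq paddr_eq0 ?sqr_ge0// !sqrf_eq0 => /andP[/eqP a0 /eqP b0].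
exact: complex_eq.
Qed.

Lemma mulcJ_normsq a : a * a^* = (normsq a)%:C.
Proof.
apply: complex_eq; rewrite ?ReM ?ImM ReJ ImJ /normsq /=; ring.
Qed.

Lemma normsqD a b : normsq (a + b) <= 2 * normsq a + 2 * normsq b.
Proof.
rewrite /normsq ReD ImD -subr_ge0.
have -> : 2 * (Re a ^+ 2 + Im a ^+ 2) + 2 * (Re b ^+ 2 + Im b ^+ 2) -
  ((Re a + Re b) ^+ 2 + (Im a + Im b) ^+ 2) =
  (Re a - Re b) ^+ 2 + (Im a - Im b) ^+ 2 by ring.
by rewrite addr_ge0 ?sqr_ge0.
Qed.

Lemma normc_ge0 a : 0 <= Normc.normc a.
Proof. by case: a => a b /=; rewrite sqrtr_ge0. Qed.

Lemma normc_sqr_normsq a : Normc.normc a ^+ 2 = normsq a.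
Proof. by case: a => a b /=; rewrite sqr_sqrtr// addr_ge0// sqr_ge0. Qed.

Lemma normr_ReM_le a b : `|Re (a * b)| <= normsq a + normsq b.
Proof.
rewrite ReM /normsq ler_norml; move: (Re a) (Im a) (Re b) (Im b) => s t u v.
have := sqr_ge0 (s + u); have := sqr_ge0 (s - u).
have := sqr_ge0 (t + v); have := sqr_ge0 (t - v).
have := sqr_ge0 s; have := sqr_ge0 t; have := sqr_ge0 u; have := sqr_ge0 v.
by move=> *; apply/andP; split; lra.
Qed.

Lemma normr_ImM_le a b : `|Im (a * b)| <= normsq a + normsq b.
Proof.
rewrite ImM /normsq ler_norml; move: (Re a) (Im a) (Re b) (Im b) => s t u v.
have := sqr_ge0 (s + v); have := sqr_ge0 (s - v).
have := sqr_ge0 (t + u); have := sqr_ge0 (t - u).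
have := sqr_ge0 s; have := sqr_ge0 t; have := sqr_ge0 u; have := sqr_ge0 v.
by move=> *; apply/andP; split; lra.
Qed.

End ComplexNumbers.

Section ComplexIntegral.
Variable R : realType.
Local Notation T := (circle R).
Local Notation C := R[i].
Local Notation mu := (@circle_measure R).
Local Notation Re := (@complex.Re R).
Local Notation Im := (@complex.Im R).
Implicit Types (f g h x y : T -> C) (a c : C).

Definition cmeasurable f :=
  measurable_fun [set: T] (fun z => Re (f z)) /\
  measurable_fun [set: T] (fun z => Im (f z)).

Definition cintegrable f :=
  mu.-integrable [set: T] (fun z => (Re (f z))%:E) /\
  mu.-integrable [set: T] (fun z => (Im (f z))%:E).

Lemma cmeasurable_cst c : cmeasurable (fun=> c).
Proof. by split; exact: measurable_cst. Qed.

Lemma cmeasurableD f g : cmeasurable f -> cmeasurable g -> cmeasurable (f \+ g).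
Proof.
move=> [fr fi] [gr gi]; split.
- under eq_fun do rewrite /= ReD; exact: measurable_funD.
- under eq_fun do rewrite /= ImD; exact: measurable_funD.
Qed.

Lemma cmeasurableM f g : cmeasurable f -> cmeasurable g -> cmeasurable (f \* g).
Proof.
move=> [fr fi] [gr gi]; split.
- under eq_fun do rewrite /= ReM.
  by apply: measurable_funB; exact: measurable_funM.
- under eq_fun do rewrite /= ImM.
  by apply: measurable_funD; exact: measurable_funM.
Qed.

Lemma cmeasurableJ f : cmeasurable f -> cmeasurable (conjf f).
Proof.
move=> [fr fi]; split; rewrite /conjf.
- by under eq_fun do rewrite /= ReJ.
- under eq_fun do rewrite /= ImJ; exact: measurable_funN.
Qed.

Lemma measurable_normsq f : cmeasurable f ->
  measurable_fun [set: T] (fun z => normsq (f z)).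
Proof.
by move=> [fr fi]; apply: measurable_funD; exact: measurable_funX.
Qed.

Lemma measurable_EFin (r : T -> R) : measurable_fun [set: T] r ->
  measurable_fun [set: T] (fun z => (r z)%:E).
Proof. by move=> mr; exact: (measurable_EFinP _ _).2. Qed.

Lemma cintegralD f g : cintegrable f -> cintegrable g ->
  cintegral (f \+ g) = cintegral f + cintegral g.
Proof.
move=> [fr fi] [gr gi]; apply: complex_eq; rewrite /cintegral /=.
- by under eq_Rintegral do rewrite ReD; exact: RintegralD.
- by under eq_Rintegral do rewrite ImD; exact: RintegralD.
Qed.

Lemma cintegralZ c f : cintegrable f ->
  cintegral (fun z => c * f z) = c * cintegral f.
Proof.
move=> [fr fi]; apply: complex_eq; rewrite ?ReM ?ImM /cintegral /=.
- under eq_Rintegral do rewrite ReM.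
  rewrite RintegralB//; first by rewrite !RintegralZl.
  + exact: (@integrableZl _ _ _ mu setT measurableT _ _ fr).
  + exact: (@integrableZl _ _ _ mu setT measurableT _ _ fi).
- under eq_Rintegral do rewrite ImM.
  rewrite RintegralD//; first by rewrite !RintegralZl.
  + exact: (@integrableZl _ _ _ mu setT measurableT _ _ fi).
  + exact: (@integrableZl _ _ _ mu setT measurableT _ _ fr).
Qed.

Lemma cintegralJ f : cintegrable f -> cintegral (conjf f) = (cintegral f)^*.
Proof.
move=> [fr fi]; apply: complex_eq; rewrite ?ReJ ?ImJ /cintegral /conjf /=.
- by under eq_Rintegral do rewrite ReJ.
- under eq_Rintegral do rewrite ImJ -mulN1r.
  by rewrite RintegralZl// mulN1r.
Qed.

Lemma cintegral_ae f g : cmeasurable f -> cmeasurable g ->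
  f = g %[ae mu] -> cintegral f = cintegral g.
Proof.
move=> [fr fi] [gr gi] fg; rewrite /cintegral /Rintegral.
congr (fine _ +i* fine _); apply: ae_eq_integral => //;
  try (by apply/measurable_EFinP); by apply: filterS fg => z /= ->.
Qed.

End ComplexIntegral.

(** * The spaces L2 and Linfty *)

Section SquareIntegrable.
Variable R : realType.
Local Notation T := (circle R).
Local Notation C := R[i].
Local Notation mu := (@circle_measure R).
Implicit Types (f g h x y phi psi : T -> C) (a c : C).

(** All closure properties of L2 are read off from this description, which
    replaces the norm by the integral of the squared modulus. *)
Lemma L2P f : L2 f <->
  cmeasurable f /\ mu.-integrable [set: T] (fun z => (normsq (f z))%:E).
Proof.
have E : (fun z => (`|(Normc.normc (f z))%:E| `^ 2)%E) =
         (fun z => (normsq (f z))%:E).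
  apply/funext => z; rewrite -normc_sqr_normsq abse_EFin poweR_EFin.
  by rewrite (ger0_norm (normc_ge0 _)) powR_mulrn// normc_ge0.
rewrite /L2 /Lp /= /finite_norm; split.
- move=> [mr mi fin]; split; first by split.
  apply/integrableP; split.
    by apply: measurable_EFin; apply: measurable_normsq.
  under eq_integral do rewrite abse_EFin ger0_norm ?normsq_ge0//.
  have := @poweR_lty _ _ 2 fin.
  by rewrite powR_Lnorm ?pnatr_eq0//= E.
- move=> [[mr mi] /integrableP[_ fin]]; split=> //.
  rewrite unlock poweR_lty//; move: fin; rewrite E.
  by under eq_integral do rewrite abse_EFin ger0_norm ?normsq_ge0//.
Qed.

Lemma circle_measureT_gt0 : (0 < mu [set: T])%E.
Proof. by rewrite probability_setT lte01. Qed.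

Lemma LinftyP f : Linfty f <->
  cmeasurable f /\ exists M, \forall z \ae mu, normsq (f z) <= M.
Proof.
rewrite /Linfty /Lp /= /finite_norm unlock circle_measureT_gt0; split.
- move=> [mr mi fin]; split; first by split.
  have [M HM] := @ess_supr_bounded _ _ _ mu (fun z => `|Normc.normc (f z)|) fin.
  exists (M ^+ 2); apply: filterS HM => z.
  rewrite (ger0_norm (normc_ge0 _)) -normc_sqr_normsq => h.
  by rewrite ler_pXn2r// nnegrE ?normc_ge0// (le_trans (normc_ge0 _) h).
- move=> [[mr mi] [M HM]]; split=> //.
  apply: (@le_lt_trans _ _ (1 + `|M|)%:E); last exact: ltry.
  apply/ess_supP; apply: filterS HM => z /= h.
  rewrite lee_fin (ger0_norm (normc_ge0 _)).
  have n0 := normc_ge0 (f z); move: h; rewrite -normc_sqr_normsq => h.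
  have := ler_norm M; move: (Normc.normc (f z)) n0 h => n n0 h hM.
  have := sqr_ge0 (n - 1); nra.
Qed.

Lemma L2_measurable f : L2 f -> cmeasurable f. Proof. by case/L2P. Qed.

Lemma Linfty_measurable f : Linfty f -> cmeasurable f.
Proof. by case/LinftyP. Qed.

Lemma L2_dominated f (g : T -> R) : cmeasurable f ->
  mu.-integrable [set: T] (fun z => (g z)%:E) ->
  (forall z, normsq (f z) <= g z) -> L2 f.
Proof.
move=> mf ig fg; apply/L2P; split=> //.
apply: le_integrable ig => //; first by apply: measurable_EFin; apply: measurable_normsq.
move=> z _; rewrite !abse_EFin lee_fin ger0_norm ?normsq_ge0//.
exact: le_trans (fg z) (ler_norm _).
Qed.

Lemma L2D f g : L2 f -> L2 g -> L2 (f \+ g).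
Proof.
move=> /L2P[mf If] /L2P[mg Ig].
apply: (@L2_dominated _ (fun z => 2 * normsq (f z) + 2 * normsq (g z))).
- exact: cmeasurableD.
- under eq_fun do rewrite EFinD !EFinM.
  by apply: integrableD => //; exact: integrableZl.
- by move=> z; exact: normsqD.
Qed.

Lemma L2Z c f : L2 f -> L2 (fun z => c * f z).
Proof.
move=> /L2P[mf If]; apply: (@L2_dominated _ (fun z => normsq c * normsq (f z))).
- exact: (cmeasurableM (@cmeasurable_cst _ c)).
- by under eq_fun do rewrite EFinM; exact: integrableZl.
- by move=> z; rewrite normsqM.
Qed.

Lemma L2B f g : L2 f -> L2 g -> L2 (f \- g).
Proof.
move=> Lf Lg; have := L2D Lf (L2Z (-1) Lg).
by congr L2; apply/funext => z /=; rewrite mulN1r.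
Qed.

Lemma L2J f : L2 f -> L2 (conjf f).
Proof.
move=> /L2P[mf If]; apply: (@L2_dominated _ (fun z => normsq (f z))) => //.
- exact: cmeasurableJ.
- by move=> z; rewrite normsqJ.
Qed.

Lemma L2M phi f : Linfty phi -> L2 f -> L2 (phi \* f).
Proof.
move=> /LinftyP[mphi [M phiM]] /L2P[mf If].
apply/L2P; split; first exact: cmeasurableM.
apply/integrableP; split.
  by apply: measurable_EFin; apply: measurable_normsq; exact: cmeasurableM.
apply: (@le_lt_trans _ _ (\int[mu]_z (`|M|%:E * (normsq (f z))%:E))%E).
  apply: ae_ge0_le_integral => //.
  - apply: measurable_EFin; apply: measurableT_comp => //.
    by apply: measurable_normsq; exact: cmeasurableM.
  - by move=> z _; rewrite mule_ge0// lee_fin ?normr_ge0 ?normsq_ge0.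
  - under eq_fun do rewrite -EFinM; apply: measurable_EFin.
    by apply: measurable_funM; [exact: measurable_cst|exact: measurable_normsq].
  - apply: filterS phiM => z hz _; rewrite abse_EFin -EFinM lee_fin.
    rewrite ger0_norm ?normsq_ge0// normsqM ler_wpM2r ?normsq_ge0//.
    exact: le_trans hz (ler_norm _).
rewrite integralZl// lte_mul_pinfty//.
exact: integrable_lty.
Qed.

Lemma Linfty_cst c : Linfty (fun=> c).
Proof.
by apply/LinftyP; split; [exact: cmeasurable_cst|exists (normsq c); apply: nearW].
Qed.

Lemma LinftyM phi psi : Linfty phi -> Linfty psi -> Linfty (phi \* psi).
Proof.
move=> /LinftyP[mf [M HM]] /LinftyP[mg [N HN]]; apply/LinftyP; split.
  exact: cmeasurableM.
exists (M * N); near=> z; rewrite /= normsqM ler_pM ?normsq_ge0//; near: z => //.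
Unshelve. all: by end_near. Qed.

Lemma LinftyD phi psi : Linfty phi -> Linfty psi -> Linfty (phi \+ psi).
Proof.
move=> /LinftyP[mf [M HM]] /LinftyP[mg [N HN]]; apply/LinftyP; split.
  exact: cmeasurableD.
exists (2 * M + 2 * N); near=> z.
apply: (le_trans (normsqD _ _)); rewrite lerD ?ler_pM2l//; near: z => //.
Unshelve. all: by end_near. Qed.

Lemma LinftyJ phi : Linfty phi -> Linfty (conjf phi).
Proof.
move=> /LinftyP[mf [M HM]]; apply/LinftyP; split; first exact: cmeasurableJ.
by exists M; apply: filterS HM => z; rewrite normsqJ.
Qed.

Lemma LinftyZ c phi : Linfty phi -> Linfty (fun z => c * phi z).
Proof. by move=> Lf; have := LinftyM (Linfty_cst c) Lf. Qed.

Lemma L2_cst c : L2 (fun=> c).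
Proof.
apply: (@L2_dominated _ (fun=> normsq c)) => //.
exact: finite_measure_integrable_cst.
Qed.

Lemma Linfty_L2 phi : Linfty phi -> L2 phi.
Proof.
move=> /L2M => /(_ _ (L2_cst 1)); congr L2.
by apply/funext => z /=; rewrite mulr1.
Qed.

End SquareIntegrable.

(** * The inner product of L2 *)

Section InnerProduct.
Variable R : realType.
Local Notation T := (circle R).
Local Notation C := R[i].
Local Notation mu := (@circle_measure R).
Local Notation Re := (@complex.Re R).
Implicit Types (f g h x y phi psi : T -> C) (a c : C).

Definition sqnorm f : R := \int[mu]_z normsq (f z).

Lemma cintegrable_mulJ f g : L2 f -> L2 g -> cintegrable (f \* conjf g).
Proof.
move=> Lf Lg.
have [mr mi] := cmeasurableM (L2_measurable Lf) (cmeasurableJ (L2_measurable Lg)).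
have I : mu.-integrable [set: T] (fun z => (normsq (f z) + normsq (g z))%:E).
  move/L2P: Lf => [_ If]; move/L2P: Lg => [_ Ig].
  by under eq_fun do rewrite EFinD; exact: integrableD.
split; apply: le_integrable I => //; try exact: measurable_EFin;
  move=> z _; rewrite !abse_EFin lee_fin /=;
  rewrite [leRHS]ger0_norm ?(addr_ge0 (normsq_ge0 _) (normsq_ge0 _))//.
- by apply: (le_trans (normr_ReM_le _ _)); rewrite normsqJ.
- by apply: (le_trans (normr_ImM_le _ _)); rewrite normsqJ.
Qed.

Lemma innerDl f g h : L2 f -> L2 g -> L2 h ->
  inner (f \+ g) h = inner f h + inner g h.
Proof.
move=> Lf Lg Lh; rewrite /inner -cintegralD; try exact: cintegrable_mulJ.
by congr cintegral; apply/funext => z /=; rewrite mulrDl.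
Qed.

Lemma innerZl c f h : L2 f -> L2 h -> inner (fun z => c * f z) h = c * inner f h.
Proof.
move=> Lf Lh; rewrite /inner -cintegralZ; last exact: cintegrable_mulJ.
by congr cintegral; apply/funext => z /=; rewrite mulrA.
Qed.

Lemma innerC f g : L2 f -> L2 g -> inner g f = (inner f g)^*.
Proof.
move=> Lf Lg; rewrite /inner -cintegralJ; last exact: cintegrable_mulJ.
by congr cintegral; apply/funext => z; rewrite /conjf /= conjcM conjCK mulrC.
Qed.

Lemma inner0l h : L2 h -> inner (fun=> 0) h = 0.
Proof.
move=> Lh; have -> : (fun=> 0 : C) = (fun z : T => 0 * (fun=> 0) z).
  by apply/funext => z; rewrite mul0r.
by rewrite (innerZl 0 (L2_cst 0) Lh) mul0r.
Qed.

Lemma innerBl f g h : L2 f -> L2 g -> L2 h ->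
  inner (f \- g) h = inner f h - inner g h.
Proof.
move=> Lf Lg Lh; have -> : f \- g = f \+ (fun z => -1 * g z).
  by apply/funext => z /=; rewrite mulN1r.
by rewrite (innerDl Lf (L2Z (-1) Lg) Lh) (innerZl (-1) Lg Lh) mulN1r.
Qed.

Lemma innerDr f g h : L2 f -> L2 g -> L2 h ->
  inner h (f \+ g) = inner h f + inner h g.
Proof.
move=> Lf Lg Lh; rewrite innerC ?innerDl// ?conjcD; last exact: L2D.
by rewrite -!innerC.
Qed.

Lemma innerBr f g h : L2 f -> L2 g -> L2 h ->
  inner h (f \- g) = inner h f - inner h g.
Proof.
move=> Lf Lg Lh; rewrite innerC ?innerBl// ?conjcD ?conjcN; last exact: L2B.
by rewrite -!innerC.
Qed.

Lemma innerZr c f h : L2 f -> L2 h ->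
  inner h (fun z => c * f z) = c^* * inner h f.
Proof.
move=> Lf Lh; rewrite innerC ?innerZl// ?conjcM; last exact: L2Z.
by rewrite -!innerC.
Qed.

Lemma innerff f : L2 f -> inner f f = (sqnorm f)%:C.
Proof.
move=> Lf; apply: complex_eq; rewrite /inner /cintegral /sqnorm /=.
- by apply: eq_Rintegral => z _; rewrite /conjf mulcJ_normsq.
- by under eq_Rintegral do [rewrite /conjf mulcJ_normsq /=];
  rewrite Rintegral_cst// mul0r.
Qed.

Lemma inner_mull phi f g : inner (phi \* f) g = inner f (conjf phi \* g).
Proof.
congr cintegral; apply/funext => z; rewrite /conjf /= conjcM conjCK.
by rewrite mulrA [f z * _]mulrC.
Qed.

Lemma inner_ael f g h : L2 f -> L2 g -> L2 h -> f = g %[ae mu] ->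
  inner f h = inner g h.
Proof.
move=> /L2_measurable mf /L2_measurable mg /L2_measurable mh fg.
apply: cintegral_ae; try (apply: cmeasurableM => //; exact: cmeasurableJ).
by apply: filterS fg => z /= ->.
Qed.

Lemma inner_aer f g h : L2 f -> L2 g -> L2 h -> f = g %[ae mu] ->
  inner h f = inner h g.
Proof. by move=> Lf Lg Lh fg; rewrite innerC// (inner_ael Lf Lg)// -innerC. Qed.

Lemma sqnorm_eq0 f : L2 f -> sqnorm f = 0 -> f = (fun=> 0) %[ae mu].
Proof.
move=> /L2P[mf If] n0.
have : (\int[mu]_z `|(normsq (f z))%:E| = 0)%E.
  under eq_integral do rewrite abse_EFin ger0_norm ?normsq_ge0//.
  rewrite -(fineK (integrable_fin_num measurableT If)).
  by congr EFin; exact: n0.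
move/(ae_eq_integral_abs mu measurableT (measurable_EFin (measurable_normsq mf))).
by apply: filterS => z /(_ I) [] /normsq_eq0.
Qed.

Lemma sqnorm_ge0 f : 0 <= sqnorm f.
Proof. by apply: Rintegral_ge0 => z _; exact: normsq_ge0. Qed.

Lemma inner_eq0P f : L2 f -> (forall h, L2 h -> inner f h = 0) ->
  f = (fun=> 0) %[ae mu].
Proof.
move=> Lf /(_ f Lf); rewrite innerff// => /(congr1 Re) /=.
exact: sqnorm_eq0.
Qed.

Lemma inner_ext f g : L2 f -> L2 g ->
  (forall h, L2 h -> inner f h = inner g h) -> f = g %[ae mu].
Proof.
move=> Lf Lg fg; have : f \- g = (fun=> 0) %[ae mu].
  by apply: inner_eq0P => [|h Lh]; [exact: L2B|rewrite innerBl// fg// subrr].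
by apply: filterS => z /= h /h /eqP; rewrite subr_eq0 => /eqP.
Qed.

Lemma sqnormZ c f : L2 f -> sqnorm (fun z => c * f z) = normsq c * sqnorm f.
Proof.
move=> Lf; apply: (@complexI R); rewrite rmorphM /= -!innerff//; last exact: L2Z.
by rewrite innerZl ?innerZr ?mulrA ?mulcJ_normsq//; exact: L2Z.
Qed.

Lemma sqnormB f g : L2 f -> L2 g ->
  sqnorm (f \- g) = sqnorm f + sqnorm g - 2 * Re (inner f g).
Proof.
move=> Lf Lg; have Re_sq x : L2 x -> sqnorm x = Re (inner x x).
  by move=> Lx; rewrite innerff.
rewrite !Re_sq//; last exact: L2B.
rewrite innerBl ?innerBr//; try exact: L2B.
rewrite (innerC Lf Lg) !(ReD, ReN) ReJ; ring.
Qed.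

(** Continuity of the inner product, in the form needed for a limit [f] of
    functions [g] whose inner product with [h] does not vary. *)
Lemma sqnorm_le_inner_cvg f h a : L2 f -> L2 h ->
  (forall e, 0 < e -> exists2 g, L2 g /\ sqnorm (f \- g) <= e & inner g h = a) ->
  inner f h = a.
Proof.
move=> Lf Lh H; apply/eqP; rewrite -subr_eq0; apply/eqP/normsq_eq0.
apply/eqP; rewrite eq_le normsq_ge0 andbT; apply/ler_addgt0Pl => e e0.
rewrite addr0; set M := sqnorm h.
have M0 : 0 <= M := sqnorm_ge0 h.
have e1 : 0 < e / (1 + M) by rewrite divr_gt0// ltr_pwDl.
have [g [Lg ge] <-] := H _ e1.
rewrite -innerBl//; move: ge; set d := f \- g => de.
have Ld : L2 d by exact: L2B.
set b := inner d h.
(* Cauchy-Schwarz for [b = <d, h>], by expanding the square of the norm of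
   [(1 + M) d - b h]; the 1 keeps the coefficient positive when [h] vanishes. *)
have := sqnorm_ge0 (fun z => (1 + M)%:C * d z - b * h z).
have -> : sqnorm (fun z => (1 + M)%:C * d z - b * h z) =
    (1 + M) ^+ 2 * sqnorm d - (2 * (1 + M) - M) * normsq b.
  rewrite (@sqnormB (fun z => (1 + M)%:C * d z) (fun z => b * h z)); try exact: L2Z.
  rewrite !sqnormZ// innerZl ?innerZr//; last exact: L2Z.
  rewrite -/b [b^* * b]mulrC mulcJ_normsq -/M {1}/normsq ReM /=; ring.
set n := normsq b => H1.
have n0 : 0 <= n := normsq_ge0 b.
have H2 : (1 + M) * n <= (1 + M) ^+ 2 * sqnorm d by nra.
have H3 : n <= (1 + M) * sqnorm d.
  by rewrite -(ler_pM2l (_ : 0 < 1 + M)) ?ltr_pwDl// mulrA -expr2.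
apply: (le_trans H3); rewrite mulrC -ler_pdivlMr// ltr_pwDl//.
Qed.

End InnerProduct.

(** * Integration over the circle *)

Section CircleIntegral.
Variable R : realType.
Local Notation T := (circle R).
Local Notation C := R[i].
Local Notation mu := (@circle_measure R).
Local Notation leb := (@lebesgue_measure R).

Lemma measurable_cis : measurable_fun [set: measurableTypeR R] (@cis R).
Proof. by []. Qed.

Lemma integral_circle (F : T -> \bar R) : measurable_fun [set: T] F ->
  (\int[mu]_z F z = \int[leb]_(t in `[0%R, 1%R]) F (cis t))%E.
Proof.
have ge0 (G : T -> \bar R) : measurable_fun [set: T] G ->
    (forall z, 0 <= G z)%E ->
    (\int[mu]_z G z = \int[leb]_(t in `[0%R, 1%R]) G (cis t))%E.
  move=> mG G0; rewrite /circle_measure ge0_integral_pushforward//.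
  rewrite preimage_setT integral_uniform//.
  - by rewrite subr0 invr1 mul1e.
  - exact: measurableT_comp.
  - by move=> t; exact: G0.
move=> mF; rewrite [LHS]integralE [RHS]integralE.
congr (_ - _)%E.
- by rewrite ge0//;
  [by apply: eq_integral => t _; rewrite !funeposE|exact: measurable_funepos].
- by rewrite ge0//;
  [by apply: eq_integral => t _; rewrite !funenegE|exact: measurable_funeneg].
Qed.


Lemma cis_expn (t : R) n : (cis t : C) ^+ n =
  cos (2 * pi * n%:R * t) +i* sin (2 * pi * n%:R * t).
Proof.
elim: n => [|n IHn]; first by rewrite expr0 mulr0 mul0r cos0 sin0.
rewrite exprS IHn.
have -> : 2 * pi * n.+1%:R * t = 2 * pi * t + 2 * pi * n%:R * t.
  by rewrite -natr1; ring.
by rewrite cosD sinD; apply: complex_eq; rewrite ?ReM ?ImM /=; ring.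
Qed.

Lemma integral_cos_sin n : (0 < n)%N ->
  (\int[leb]_(t in `[0%R, 1%R]) (cos (2 * pi * n%:R * t))%:E = 0)%E /\
  (\int[leb]_(t in `[0%R, 1%R]) (sin (2 * pi * n%:R * t))%:E = 0)%E.
Proof.
move=> n0; set w := 2 * pi * n%:R.
have w0 : w != 0 by rewrite !mulf_neq0// ?pnatr_eq0 -?lt0n// gt_eqF// pi_gt0.
have dw (x : R) : is_derive x 1 (fun t : R => w * t) w.
  by apply: is_derive_eq; rewrite ?scaler0 ?addr0 ?add0r /GRing.scale /= mulr1.
have sinw : sin w = 0.
  rewrite /w; elim: (n) => [|k IH]; first by rewrite mulr0 sin0.
  have -> : 2 * pi * k.+1%:R = 2 * pi * k%:R + pi *+ 2 :> R.
    by rewrite -natr1 -mulr_natl; ring.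
  by rewrite sinD2pi.
have cosw : cos w = 1.
  rewrite /w; elim: (n) => [|k IH]; first by rewrite mulr0 cos0.
  have -> : 2 * pi * k.+1%:R = 2 * pi * k%:R + pi *+ 2 :> R.
    by rewrite -natr1 -mulr_natl; ring.
  by rewrite cosD2pi.
have dS (x : R) : is_derive x 1 (fun t : R => w^-1 * sin (w * t)) (cos (w * x)).
  have := @is_deriveZ _ _ _ (fun t : R => sin (w * t)) w^-1 x 1 _
    (is_derive1_comp (is_derive_sin _) (dw x)).
  by move=> h; apply: (is_derive_eq h); rewrite /GRing.scale/= mulrCA mulVf ?mulr1.
have dC (x : R) : is_derive x 1 (fun t : R => - w^-1 * cos (w * t)) (sin (w * x)).
  have := @is_deriveZ _ _ _ (fun t : R => cos (w * t)) (- w^-1) x 1 _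
    (is_derive1_comp (is_derive_cos _) (dw x)).
  move=> h; apply: (is_derive_eq h).
  by rewrite /GRing.scale/= !mulNr mulrN opprK mulrCA mulVf ?mulr1.
have D (f F : R -> R) : (forall x : R, is_derive x 1 F (f x)) -> continuous f ->
    F 1 = F 0 -> (\int[leb]_(t in `[0%R, 1%R]) (f t)%:E = 0)%E.
  move=> dF cf F10; have cF x : {for x, continuous F}.
    apply/differentiable_continuous/derivable1_diffP.
    by have [] := dF x.
  rewrite (@continuous_FTC2 _ f F)//.
  - by rewrite F10 subee.
  - exact: continuous_subspaceT.
  - split=> [x _||]; first by have [] := dF x.
    + exact/cvg_at_right_filter/cF.
    + exact/cvg_at_left_filter/cF.
  - by move=> x _; rewrite derive1E; have [_ ->] := dF x.
have cw : continuous (fun t : R => w * t) by move=> t; exact: mulrl_continuous.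
split.
- apply: D dS _ _; last by rewrite mulr1 mulr0 sinw sin0.
  by move=> t; apply: continuous_comp; [exact: cw|exact: continuous_cos].
- apply: D dC _ _; last by rewrite mulr1 mulr0 cosw cos0.
  by move=> t; apply: continuous_comp; [exact: cw|exact: continuous_sin].
Qed.

End CircleIntegral.

(** * The monomials z^n *)

Section Monomials.
Variable R : realType.
Local Notation T := (circle R).
Local Notation C := R[i].
Implicit Types (f g h x y : T -> C) (z : T) (m n : int).

Definition zpow n : T -> C := fun z => (z : C) ^ n.

Lemma normsq_circle z : normsq (z : C) = 1.
Proof.
case: z => a /= /eqP a1; apply: (@complexI R).
by rewrite -mulcJ_normsq -normCK a1 expr1n.
Qed.

Lemma circle_neq0 z : (z : C) != 0.
Proof.
apply/eqP => z0; have := normsq_circle z; rewrite z0 /normsq /= expr0n addr0.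
by move/eqP; rewrite eq_sym oner_eq0.
Qed.

Lemma circleJ z : (z : C)^* = (z : C)^-1.
Proof.
apply: (mulfI (circle_neq0 z)).
by rewrite mulcJ_normsq normsq_circle mulfV ?circle_neq0.
Qed.

Lemma zpow0 z : zpow 0 z = 1. Proof. by rewrite /zpow expr0z. Qed.
Lemma zpow1 z : zpow 1 z = z. Proof. by rewrite /zpow expr1z. Qed.

Lemma zpowD m n z : zpow (m + n) z = zpow m z * zpow n z.
Proof. by rewrite /zpow expfzDr// circle_neq0. Qed.

Lemma zpowJ n z : (zpow n z)^* = zpow (- n) z.
Proof.
rewrite /zpow -exprz_inv -circleJ; exact: fmorphXz.
Qed.

Lemma conjf_zpow n : conjf (zpow n) = zpow (- n).
Proof. by apply/funext => z; rewrite /conjf zpowJ. Qed.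

Lemma normsq_zpow n z : normsq (zpow n z) = 1.
Proof.
apply: (@complexI R); rewrite -mulcJ_normsq zpowJ -zpowD subrr zpow0.
by [].
Qed.

Lemma zpowN1 z : zpow (-1) z = (z : C)^*.
Proof. by rewrite -zpowJ zpow1. Qed.

(** The sigma-algebra of the circle is the final one along [cis]. *)
Lemma measurable_circle_fun (r : T -> R) :
  measurable_fun [set: measurableTypeR R] (r \o @cis R) ->
  measurable_fun [set: T] r.
Proof.
by move=> mr _ Y mY; rewrite setTI; exact: (mr measurableT Y mY).
Qed.

Lemma cmeasurable_zpow n : cmeasurable (zpow n).
Proof.
have mz : cmeasurable (fun z : T => (z : C)).
  have mt : measurable_fun [set: measurableTypeR R] (fun t : R => 2 * pi * t).
    exact: measurable_funM.
  split; apply: measurable_circle_fun.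
  - apply: (@measurableT_comp _ _ _ _ _ _ (@cos R) _ _ _ mt).
    exact: continuous_measurable_fun (@continuous_cos R).
  - apply: (@measurableT_comp _ _ _ _ _ _ (@sin R) _ _ _ mt).
    exact: continuous_measurable_fun (@continuous_sin R).
have mnat (k : nat) : cmeasurable (zpow k).
  elim: k => [|k IH].
    by rewrite (_ : zpow 0 = fun=> 1);
      [exact: cmeasurable_cst|apply/funext => z; exact: zpow0].
  have := cmeasurableM mz IH; congr cmeasurable; apply/funext => z.
  by rewrite -[k.+1]addn1 PoszD addrC zpowD zpow1.
case: n => k; first exact: mnat.
by rewrite NegzE -conjf_zpow; exact: cmeasurableJ.
Qed.

Lemma Linfty_zpow n : Linfty (zpow n).
Proof.
apply/LinftyP; split; first exact: cmeasurable_zpow.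
by exists 1; apply: nearW => z; rewrite normsq_zpow.
Qed.

Lemma L2_zpow n : L2 (zpow n).
Proof. exact/Linfty_L2/Linfty_zpow. Qed.

Lemma L2_zpowM n x : L2 x -> L2 (zpow n \* x).
Proof. exact: L2M (Linfty_zpow n). Qed.

Lemma fourier_coefE f n : fourier_coef f n = inner f (zpow n).
Proof. by congr cintegral; apply/funext => z /=; rewrite /conjf zpowJ. Qed.

Lemma cintegral_zpow n : cintegral (zpow n) = (n == 0)%:R.
Proof.
have mE k := cmeasurable_zpow k.
have pos (k : nat) : (0 < k)%N -> cintegral (zpow k) = 0.
  move=> k0; have [mr mi] := mE k; have [icos isin] := integral_cos_sin R k0.
  apply: complex_eq; rewrite /cintegral /Rintegral /=.
  - rewrite integral_circle; last exact: measurable_EFin.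
    transitivity (fine (\int[@lebesgue_measure R]_(t in `[0%R, 1%R])
        (cos (2 * pi * k%:R * t))%:E)%E); last by rewrite icos.
    congr fine; apply: eq_integral => t _.
    by rewrite cis_expn.
  - rewrite integral_circle; last exact: measurable_EFin.
    transitivity (fine (\int[@lebesgue_measure R]_(t in `[0%R, 1%R])
        (sin (2 * pi * k%:R * t))%:E)%E); last by rewrite isin.
    congr fine; apply: eq_integral => t _.
    by rewrite cis_expn.
case: n => [[|k]|k].
- have -> : zpow 0 = zpow 0 \* conjf (zpow 0).
    by apply/funext => z /=; rewrite conjf_zpow -zpowD oppr0 addr0.
  rewrite -/(inner _ _) innerff; last exact: L2_zpow.
  apply: complex_eq => //=; rewrite /sqnorm.
  under eq_Rintegral do rewrite normsq_zpow.
  rewrite Rintegral_cst// mul1r -[RHS]/(fine 1%E).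
  by congr fine; exact: probability_setT.
- exact: pos.
- rewrite NegzE -conjf_zpow cintegralJ ?pos ?conjC0//.
  have := cintegrable_mulJ (L2_zpow k.+1) (L2_zpow 0); congr cintegrable.
  by apply/funext => z /=; rewrite conjf_zpow -zpowD oppr0 addr0.
Qed.

Lemma inner_zpow m n : inner (zpow m) (zpow n) = (m == n)%:R.
Proof.
rewrite -subr_eq0 -cintegral_zpow; congr cintegral; apply/funext => z /=.
by rewrite conjf_zpow -zpowD.
Qed.

Lemma fourier_coef_zpowM f m n : fourier_coef (zpow m \* f) n = fourier_coef f (n - m).
Proof.
rewrite !fourier_coefE inner_mull conjf_zpow; congr inner.
by apply/funext => z /=; rewrite -zpowD addrC.
Qed.

End Monomials.

(** * Polynomial approximation of arcs *)

Section ArcsDetermine.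
Variable R : realType.
Local Notation leb := (@lebesgue_measure R).

Lemma bernoulli_lower (u : R) N : 0 <= u <= 1 -> 1 - N%:R * u <= (1 - u) ^+ N.
Proof.
move=> /andP[u0 u1]; elim: N => [|N IH]; first by rewrite mul0r subr0 expr0.
rewrite exprS; apply: (le_trans _ (ler_wpM2l _ IH)); last by rewrite subr_ge0.
rewrite -natr1; have : 0 <= N%:R :> R by []; nra.
Qed.

Lemma bernoulli_upper (u : R) N : 0 <= u <= 1 ->
  (1 - u) ^+ N * (1 + N%:R * u) <= 1.
Proof.
move=> /andP[u0 u1]; have u1' : 0 <= 1 - u by rewrite subr_ge0.
elim: N => [|N IH]; first by rewrite mul0r addr0 expr0 mulr1.
apply: le_trans IH; rewrite exprS -mulrA mulrCA.
rewrite ler_wpM2l ?exprn_ge0//.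
rewrite -natr1; have : 0 <= N%:R :> R by []; nra.
Qed.

(** The polynomials [(1 - w ^ n) ^ (2 ^ n)] take [0, 1] into itself and jump
    from 1 to 0 at [w = 1 / 2] in the limit: by the two Bernoulli inequalities
    the n-th one is at least [1 - (2 w) ^ n] and at most [(2 w) ^ (- n)]. *)
Lemma step_cvg_below (w : R) : 0 <= w -> w < 1 / 2 ->
  (1 - w ^+ n) ^+ (2 ^ n) @[n --> \oo] --> (1 : R).
Proof.
move=> w0 w1; have b n : 0 <= w ^+ n <= 1.
  by rewrite exprn_ge0//= exprn_ile1//; lra.
apply: (@squeeze_cvgr _ _ _ _ (fun n => 1 - (2 * w) ^+ n) (cst 1)).
- apply: nearW => n; apply/andP; split.
    by apply: le_trans (bernoulli_lower _ (b n)); rewrite natrX exprMn.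
  have /andP[b0 b1] := b n.
  by apply: exprn_ile1; rewrite ?subr_ge0// lerBlDr lerDl.
- rewrite -[X in _ --> X]subr0; apply: cvgB; first exact: cvg_cst.
  by apply: cvg_expr; rewrite ger0_norm; lra.
- exact: cvg_cst.
Qed.

Lemma step_cvg_above (w : R) : 1 / 2 < w -> w <= 1 ->
  (1 - w ^+ n) ^+ (2 ^ n) @[n --> \oo] --> (0 : R).
Proof.
move=> w0 w1; have w2 : 0 < w by lra.
have b n : 0 <= w ^+ n <= 1.
  by apply/andP; split; [apply: exprn_ge0; lra|apply: exprn_ile1; lra].
apply: (@squeeze_cvgr _ _ _ _ (cst 0) (fun n => ((2 * w)^-1) ^+ n)).
- apply: nearW => n; rewrite exprn_ge0/=; last by rewrite subr_ge0; case/andP: (b n).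
  have p0 : 0 < (2 * w) ^+ n by rewrite exprn_gt0//; lra.
  rewrite exprVn -[leRHS]mul1r ler_pdivlMr//.
  apply: le_trans (bernoulli_upper (2 ^ n) (b n)).
  apply: ler_wpM2l; first by rewrite exprn_ge0// subr_ge0; case/andP: (b n).
  by rewrite natrX -exprMn lerDr.
- exact: cvg_cst.
- apply: cvg_expr; rewrite ger0_norm ?invr_ge0; last by lra.
  by rewrite invf_lt1; lra.
Qed.

(** By Lebesgue differentiation an integrable function is almost everywhere
    the derivative of its indefinite integral, which is 0 here. *)
Lemma zero_initial_integrals_ae (h : R -> R) :
  leb.-integrable `[0, 1] (EFin \o h) ->
  (forall s : R, 0 < s -> s < 1 ->
    (\int[leb]_(t in `[0%R, s]) (h t)%:E = 0)%E) ->
  (\int[leb]_(t in `[0%R, 1%R]) `|(h t)%:E| = 0)%E.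
Proof.
move=> ih h0; pose g := h \_ `[0, 1].
have ig : leb.-integrable setT (EFin \o g).
  by rewrite /g -restrict_EFin; apply/integrable_restrict => //; rewrite setTI.
have iy y : leb.-integrable [set` `[0, y]] (EFin \o g) by exact: integrableS ig.
have locg : locally_integrable [set: R] g by exact: integrable_locally.
have := FTC1 (a := BLeft 0) iy locg => /= FT.
have g0 : {ae leb, forall x, 0 < x -> x < 1 -> h x = 0}.
  apply: filterS FT; first exact: (ae_filter_ringOfSetsType leb).
  move=> x H x0 x1.
  have [|_] := H; first by rewrite lte_fin.
  rewrite [RHS](_ : _ = h x); last first.
    by rewrite /g patchE mem_set//= in_itv/= !ltW.
  move=> <-; rewrite derive1E.
  set F := fun y : R => _.
  have : \forall y \near x, F y = cst 0 y.
    near=> y; rewrite /F /Rintegral.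
    have y0 : 0 < y by near: y; exact: lt_nbhsr.
    have y1 : y < 1 by near: y; exact: lt_nbhsl.
    rewrite -[RHS]/(fine 0%E) -(h0 _ y0 y1); congr fine.
    apply: eq_integral => t; rewrite inE/= in_itv/= => /andP[t0 ty].
    by rewrite /g patchE mem_set//= in_itv/= t0/= (le_trans ty)// ltW.
  move=> /near_eq_derive -> //; exact: derive_cst.
have mh : @measurable_fun _ _ (measurableTypeR R) _ `[0, 1] (fun t => (`|h t|)%:E).
  have /integrableP[/measurable_EFinP mh _] := ih.
  by apply/measurable_EFinP; exact: measurableT_comp.
have sub b c : [set` Interval (BSide b 0) (BSide c 1)] `<=` (`[0, 1] : set R).
  by apply: subset_itv; rewrite bnd_simp.
rewrite -integral_itv_bndo_bndc; last first.
  exact: measurable_funS mh.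
rewrite -integral_itv_obnd_cbnd; last first.
  exact: measurable_funS mh.
transitivity (\int[leb]_(t in `]0%R, 1%R[) (cst 0 t : \bar R))%E;
  last by rewrite integral0.
apply: ae_eq_integral => //.
  exact: measurable_funS mh.
apply: filterS g0; first exact: (ae_filter_ringOfSetsType leb).
move=> t H; rewrite /= in_itv/= => /andP[t0 t1].
by rewrite H// normr0.
Unshelve. all: by end_near. Qed.

End ArcsDetermine.

(** * Uniqueness of Fourier coefficients *)

Section FourierUniqueness.
Variable R : realType.
Local Notation T := (circle R).
Local Notation C := R[i].
Local Notation mu := (@circle_measure R).
Local Notation leb := (@lebesgue_measure R).
Local Notation Re := (@complex.Re R).
Local Notation Im := (@complex.Im R).
Implicit Types (f g h phi psi : T -> C) (z : T) (m n : int) (s t : R).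

Definition fourier_null f := L2 f /\ forall n, fourier_coef f n = 0.

(** The bounded functions that preserve [fourier_null] form an algebra
    containing all [z ^ n]. This is a convenient substitute for the algebra of
    trigonometric polynomials: its stability under the ring operations needs no
    computation with coefficients. *)
Definition null_multiplier phi :=
  Linfty phi /\ forall f, fourier_null f -> fourier_null (phi \* f).

Lemma fourier_coefD f g n : L2 f -> L2 g ->
  fourier_coef (f \+ g) n = fourier_coef f n + fourier_coef g n.
Proof. by move=> Lf Lg; rewrite !fourier_coefE innerDl//; exact: L2_zpow. Qed.

Lemma fourier_coef_ae f g n : L2 f -> L2 g -> f = g %[ae mu] ->
  fourier_coef f n = fourier_coef g n.
Proof.
by move=> Lf Lg fg; rewrite !fourier_coefE (inner_ael Lf Lg (L2_zpow R n) fg).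
Qed.

Lemma fourier_coefZ c f n : L2 f ->
  fourier_coef (fun z => c * f z) n = c * fourier_coef f n.
Proof. by move=> Lf; rewrite !fourier_coefE innerZl//; exact: L2_zpow. Qed.

Lemma null_multiplier_cst c : null_multiplier (fun=> c).
Proof.
split=> [|f [Lf nf]]; first exact: Linfty_cst.
by split=> [|n]; [exact: L2Z|rewrite [LHS]fourier_coefZ// nf mulr0].
Qed.

Lemma null_multiplier_zpow m : null_multiplier (zpow m).
Proof.
split=> [|f [Lf nf]]; first exact: Linfty_zpow.
by split=> [|n]; [apply: L2M => //; exact: Linfty_zpow|rewrite fourier_coef_zpowM].
Qed.

Lemma null_multiplierD phi psi : null_multiplier phi -> null_multiplier psi ->
  null_multiplier (phi \+ psi).
Proof.
move=> [Lphi nphi] [Lpsi npsi]; split=> [|f nf]; first exact: LinftyD.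
have [L1 n1] := nphi f nf; have [L2' n2] := npsi f nf.
have -> : (phi \+ psi) \* f = (phi \* f) \+ (psi \* f).
  by apply/funext => z /=; rewrite mulrDl.
by split=> [|n]; [exact: L2D|rewrite fourier_coefD// n1 n2 addr0].
Qed.

Lemma null_multiplierM phi psi : null_multiplier phi -> null_multiplier psi ->
  null_multiplier (phi \* psi).
Proof.
move=> [Lphi nphi] [Lpsi npsi]; split=> [|f nf]; first exact: LinftyM.
have -> : (phi \* psi) \* f = phi \* (psi \* f).
  by apply/funext => z /=; rewrite mulrA.
exact/nphi/npsi.
Qed.

Lemma null_multiplierX phi k : null_multiplier phi ->
  null_multiplier (fun z => phi z ^+ k).
Proof.
move=> nphi; elim: k => [|k IH]; first exact: null_multiplier_cst.
have := null_multiplierM nphi IH; congr null_multiplier.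
by apply/funext => z /=; rewrite exprS.
Qed.

(** The affine function of [Re (z * conj c)], with [c] the midpoint of the arc
    from [1] to [cis s], that takes the value [1 / 2] at both endpoints of the
    arc; the factor [1 / 4] keeps it between 0 and 1. It is smaller than
    [1 / 2] exactly inside the arc, as [arc_weight_cis] shows. *)
Definition arc_weight s z : R :=
  1 / 2 + (cos (pi * s) - Re ((z : C) * (cis (s / 2) : C)^*)) / 4.

Lemma arc_weight_itv s z : 0 <= arc_weight s z <= 1.
Proof.
rewrite /arc_weight; have := cos_geN1 (pi * s); have := cos_le1 (pi * s).
set a := (z : C) * _; have : normsq a = 1.
  by rewrite normsqM normsqJ !normsq_circle mulr1.
rewrite /normsq; move: (Re a) (Im a) (cos _) => u v w uv w1 w2.
by apply/andP; split; nra.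
Qed.

Lemma arc_weight_cis s t :
  arc_weight s (cis t) = 1 / 2 + sin (pi * t) * sin (pi * (t - s)) / 2.
Proof.
rewrite /arc_weight ReM ReJ ImJ /= mulrN opprK -cosB.
have -> : 2 * pi * t - 2 * pi * (s / 2) = pi * t + pi * (t - s) by field.
have -> : pi * s = pi * t - pi * (t - s) by ring.
by rewrite cosB cosD; field.
Qed.

Lemma null_multiplier_arc_weight s :
  null_multiplier (fun z => (arc_weight s z)%:C).
Proof.
set a := (cis (s / 2) : C).
have -> : (fun z => (arc_weight s z)%:C) =
    (fun z => (1 / 2 + cos (pi * s) / 4)%:C) \+
    (((fun=> - (1 / 8)%:C * a^*) \* zpow 1) \+
     ((fun=> - (1 / 8)%:C * a) \* zpow (-1))).
  apply/funext => z; rewrite /= zpow1 zpowN1 /arc_weight -/a.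
  move: (z : C) a => u v; apply: complex_eq.
    by rewrite !(ReD, ReM, ImM, ReJ, ImJ, ReN, ImN) /=; field.
  by rewrite !(ImD, ReM, ImM, ReJ, ImJ, ReN, ImN) /=; ring.
apply: null_multiplierD; first exact: null_multiplier_cst.
by apply: null_multiplierD; apply: null_multiplierM;
  [exact: null_multiplier_cst|exact: null_multiplier_zpow|
   exact: null_multiplier_cst|exact: null_multiplier_zpow].
Qed.

Definition arc_step s k z : R := (1 - arc_weight s z ^+ k) ^+ (2 ^ k).

Lemma null_multiplier_arc_step s k :
  null_multiplier (fun z => (arc_step s k z)%:C).
Proof.
have -> : (fun z => (arc_step s k z)%:C) =
    (fun z => (1 + (-1) * (arc_weight s z)%:C ^+ k) ^+ (2 ^ k)).
  by apply/funext => z; rewrite /arc_step rmorphXn rmorphB rmorphXn mulN1r.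
apply: null_multiplierX; apply: (null_multiplierD (null_multiplier_cst 1)).
apply: (null_multiplierM (null_multiplier_cst (-1))).
exact/null_multiplierX/null_multiplier_arc_weight.
Qed.

Lemma arc_step_itv s k z : 0 <= arc_step s k z <= 1.
Proof.
have /andP[w0 w1] := arc_weight_itv s z.
have u0 : 0 <= 1 - arc_weight s z ^+ k by rewrite subr_ge0 exprn_ile1.
by rewrite exprn_ge0//= exprn_ile1// gerBl exprn_ge0.
Qed.

Lemma arc_step_cvg s t : 0 < s -> s < 1 -> 0 < t -> t < 1 -> t != s ->
  arc_step s k (cis t) @[k --> \oo] --> ((t < s)%R%:R : R).
Proof.
move=> s0 s1 t0 t1 ts.
have sin_pi u : 0 < u -> u < 1 -> 0 < sin (pi * u) :> R.
  move=> u0 u1; have := pi_gt0 R => pi0; apply: sin_gt0_pi.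
  by rewrite mulr_gt0//= gtr_pMr.
have pt := sin_pi t t0 t1.
have /andP[w0 w1] := arc_weight_itv s (cis t).
rewrite /arc_step; case: ltgtP ts => // ts _ /=.
- apply: step_cvg_below => //; rewrite arc_weight_cis -opprB mulrN sinN mulrN.
  have : 0 < sin (pi * (s - t)) by apply: sin_pi; lra.
  move=> h; have := mulr_gt0 pt h; lra.
- apply: step_cvg_above => //; rewrite arc_weight_cis.
  have : 0 < sin (pi * (t - s)) by apply: sin_pi; lra.
  move=> h; have := mulr_gt0 pt h; lra.
Qed.

(** Dominated convergence turns the vanishing of the integrals against the
    [arc_step]s into the vanishing of the integrals over the arcs from [1] to
    [cis s]. *)
Lemma arc_steps_determine (r : T -> R) :
  mu.-integrable [set: T] (fun z => (r z)%:E) ->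
  (forall s k, (\int[mu]_z (arc_step s k z * r z)%:E = 0)%E) ->
  (\int[mu]_z `|(r z)%:E| = 0)%E.
Proof.
move=> ir null; have mr : measurable_fun [set: T] r.
  by apply/(measurable_EFinP _ _).1; exact: measurable_int ir.
pose h (t : measurableTypeR R) : R := r (cis t).
have mh : measurable_fun [set: measurableTypeR R] h by exact: measurableT_comp.
have mnr : measurable_fun [set: T] (fun z => `|(r z)%:E|)%E.
  by apply: measurableT_comp => //; exact: measurable_EFin.
have ih : leb.-integrable `[0, 1] (EFin \o h).
  apply/integrableP; split.
    by apply/measurable_EFinP; exact: measurable_funS mh.
  have /integrableP[_] := ir; rewrite integral_circle//.
have mstep s k : measurable_fun [set: T] (arc_step s k).
  by have [/Linfty_measurable[]] := null_multiplier_arc_step s k.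
have mF s k : measurable_fun [set: measurableTypeR R]
    (fun t => arc_step s k (cis t) * h t).
  apply: measurable_funM => //; apply: (measurableT_comp (mstep s k)).
  exact: measurable_cis.
rewrite integral_circle//; apply: (zero_initial_integrals_ae ih) => s s0 s1.
rewrite -integral_itv_bndo_bndc; last first.
  by apply: measurable_funS (measurable_int _ ih) => //;
    apply: subset_itv; rewrite bnd_simp// ltW.
have -> : `[0, s[%classic = `[0, 1]%classic `&` `]-oo, s[%classic :> set R.
  apply/seteqP; split=> t /=; rewrite !in_itv/=.
    by move=> /andP[-> ts]; rewrite ts (ltW (lt_trans ts s1)).
  by move=> [/andP[-> _] ->].
rewrite integral_mkcondr.
pose F k (t : measurableTypeR R) := (arc_step s k (cis t) * h t)%:E.
have F0 k : (\int[leb]_(t in `[0%R, 1%R]) F k t = 0)%E.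
  rewrite -[RHS](null s k) integral_circle//.
  by apply: measurable_EFin; exact: measurable_funM.
have [] := @dominated_convergence _ _ _ leb `[0%R, 1%R]%classic _ F
  ((EFin \o h) \_ `]-oo, s[) (fun t => `|(h t)%:E|)%E.
- by [].
- by move=> k; apply/measurable_EFinP; exact: measurable_funS (mF s k).
- apply: (measurable_funS measurableT) => //.
  apply/(measurable_restrictT _ _).1 => //.
  by apply/measurable_EFinP; exact: measurable_funS mh.
(* The limit of the steps is not controlled at the endpoints of the arc. *)
- exists ([set 0] `|` [set s] `|` [set 1]); split.
  + by apply: measurableU => //; exact: measurableU.
  + have n1 (x : R) : leb [set x] = 0%E := lebesgue_measure_set1 x.
    have m1 (x : R) : measurable [set x : measurableTypeR R] by [].
    apply: null_set_setU; [exact: measurableU|exact: m1| |exact: n1].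
    by apply: null_set_setU; [exact: m1|exact: m1|exact: n1|exact: n1].
  + move=> t; apply: contra_notP => /= /not_orP[/not_orP[/eqP t0 /eqP ts] /eqP t1].
    rewrite in_itv/= => /andP[t0' t1'].
    have {}t0 : 0 < t by rewrite lt_neqAle eq_sym t0.
    have {}t1 : t < 1 by rewrite lt_neqAle t1.
    have -> : ((EFin \o h) \_ `]-oo, s[) t = ((t < s)%R%:R * h t)%:E.
      rewrite patchE; case: ifPn; rewrite ?inE ?notin_setE/= in_itv/=.
        by move=> ->; rewrite mul1r.
      by move/negP/negbTE => ->; rewrite mul0r.
    apply: cvg_EFin; first exact: nearW.
    by apply: cvgMl; exact: arc_step_cvg.
- exact: integrable_abse.
- apply: nearW => t k _; rewrite /F abse_EFin lee_fin normrM ler_piMl//.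
  by have /andP[a0 a1] := arc_step_itv s k (cis t); rewrite ger0_norm.
move=> _ _; under eq_fun do rewrite F0.
by move=> /cvg_lim <- //; rewrite lim_cst.
Qed.

Lemma L2_cintegrable f : L2 f -> cintegrable f.
Proof.
move=> Lf; have := cintegrable_mulJ Lf (L2_cst 1); congr cintegrable.
by apply/funext => z; rewrite /conjf /= conjC1 mulr1.
Qed.

(** The steps are null multipliers, so the real and imaginary parts of [f]
    have zero integral against each of them. *)
Theorem fourier_null_ae f : fourier_null f -> f = (fun=> 0) %[ae mu].
Proof.
move=> nf; have [Lf _] := nf; have [ir ii] := L2_cintegrable Lf.
have step s k : (\int[mu]_z (arc_step s k z * Re (f z))%:E = 0)%E /\
    (\int[mu]_z (arc_step s k z * Im (f z))%:E = 0)%E.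
  have [Lg /(_ 0)] := (null_multiplier_arc_step s k).2 f nf.
  have [jr ji] := L2_cintegrable Lg; rewrite /fourier_coef oppr0.
  have -> : (fun z => ((fun z => (arc_step s k z)%:C) \* f) z * (z : C) ^ 0) =
      (fun z => (arc_step s k z)%:C) \* f.
    by apply/funext => z; rewrite expr0z mulr1.
  have Er z : Re ((arc_step s k z)%:C * f z) = arc_step s k z * Re (f z).
    by rewrite ReM /= mul0r subr0.
  have Ei z : Im ((arc_step s k z)%:C * f z) = arc_step s k z * Im (f z).
    by rewrite ImM /= mul0r addr0.
  move=> c0; split.
  - under eq_integral do rewrite -Er.
    rewrite -(fineK (integrable_fin_num measurableT jr)).
    by congr EFin; exact: (congr1 Re c0).
  - under eq_integral do rewrite -Ei.
    rewrite -(fineK (integrable_fin_num measurableT ji)).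
    by congr EFin; exact: (congr1 Im c0).
have r0 := (ae_eq_integral_abs mu measurableT (measurable_int mu ir)).1
  (arc_steps_determine ir (fun s k => (step s k).1)).
have i0 := (ae_eq_integral_abs mu measurableT (measurable_int mu ii)).1
  (arc_steps_determine ii (fun s k => (step s k).2)).
near=> z => _; apply: complex_eq; apply: EFin_inj; near: z.
- by apply: filterS r0 => z; exact.
- by apply: filterS i0 => z; exact.
Unshelve. all: by end_near. Qed.

End FourierUniqueness.

(** * Completeness of L2 and the projection onto H2 *)

Section RieszFischer.
Context d (T : measurableType d) (R : realType).
Variable P : probability T R.
Variable u : nat -> T -> R.
Hypothesis mu_ : forall k, measurable_fun [set: T] (u k).
Hypothesis u_cauchy : forall k j, (k <= j)%N ->
  (\int[P]_x ((u j x - u k x) ^+ 2)%:E <= (4 ^- k)%:E)%E.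

Let mB k j : measurable_fun [set: T] (fun x => u j x - u k x).
Proof. exact: measurable_funB. Qed.

Let mEB k j : measurable_fun [set: T] (fun x => (u j x - u k x)%:E).
Proof. by apply/measurable_EFinP. Qed.

Let mB2 k j : measurable_fun [set: T] (fun x => ((u j x - u k x) ^+ 2)%:E).
Proof. by apply/measurable_EFinP; exact: measurable_funX. Qed.

(* The arithmetic-geometric inequality [|v| <= 2 ^ k v ^ 2 + 2 ^ (- k)] trades
   the quadratic estimate for a summable one of the first power. *)
Let integral_step_le k :
  (\int[P]_x `|(u k.+1 x - u k x)%:E| <= (2 / 2 ^+ k)%:E)%E.
Proof.
pose v x := u k.+1 x - u k x.
have mv : measurable_fun [set: T] (fun x => (v x ^+ 2)%:E) by exact: mB2.
apply: (@le_trans _ _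
  (\int[P]_x ((2 ^+ k)%:E * (v x ^+ 2)%:E + (2 ^- k)%:E))%E).
  apply: ge0_le_integral => //.
  - exact: measurableT_comp.
  - by apply: emeasurable_funD; [exact: measurable_funeM|exact: measurable_cst].
  - move=> x _; rewrite -EFinM -EFinD abse_EFin lee_fin.
    rewrite -/(v x); have p0 : 0 < 2 ^+ k :> R by exact: exprn_gt0.
    set p := 2 ^+ k in p0 *; set a := `|v x|.
    have -> : v x ^+ 2 = a ^+ 2 by rewrite /a real_normK// num_real.
    rewrite -subr_ge0.
    have -> : p * a ^+ 2 + p^-1 - a = p * ((a - p^-1 / 2) ^+ 2 + 3 / 4 * p^-1 ^+ 2).
      by field; rewrite gt_eqF.
    apply: mulr_ge0; first exact: ltW.
    by rewrite addr_ge0 ?sqr_ge0// mulr_ge0// sqr_ge0.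
rewrite ge0_integralD//.
- rewrite ge0_integralZl// ?lee_fin ?exprn_ge0//; last first.
    by move=> x _; rewrite lee_fin sqr_ge0.
  rewrite integral_cst// [X in (_ + _ * X)%E](_ : _ = 1%E); last first.
    exact: probability_setT.
  rewrite mule1.
  apply: (@le_trans _ _ ((2 ^+ k)%:E * (4 ^- k)%:E + (2 ^- k)%:E)%E).
    by rewrite leeD2r// lee_wpmul2l// ?lee_fin ?exprn_ge0// u_cauchy.
  rewrite -EFinM -EFinD lee_fin.
  have -> : 4 ^- k = (2 ^- k) * (2 ^- k) :> R.
    by rewrite -invfM -exprMn -natrM.
  by rewrite mulrA mulfV ?mul1r ?expf_neq0// [leRHS]mulr_natl.
- by move=> x _; apply: mule_ge0; rewrite lee_fin; [exact: exprn_ge0|exact: sqr_ge0].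
- exact: measurable_funeM.
Qed.

Let cvg_ae : {ae P, forall x, cvgn (u ^~ x)}.
Proof.
pose S x := (\sum_(k <oo) `|(u k.+1 x - u k x)%:E|)%E.
have mS k : measurable_fun [set: T] (fun x => `|(u k.+1 x - u k x)%:E|)%E.
  exact: measurableT_comp.
have S_fin : (\int[P]_x S x < +oo)%E.
  rewrite integral_nneseries//.
  apply: (@le_lt_trans _ _ (\sum_(k <oo) (4 / (2 ^ (k + 1))%:R)%:E)%E).
    apply: lee_nneseries => k *; first by apply: integral_ge0.
    apply: (le_trans (integral_step_le k)).
    rewrite lee_fin natrX addn1 exprS le_eqVlt; apply/orP; left; apply/eqP.
    by field; rewrite expf_neq0.
  have /cvg_lim := @cvg_geometric_eseries_half R 4 0.
  by move=> /(_ _)-> //; rewrite ltry.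
have iS : P.-integrable [set: T] S.
  apply/integrableP; split.
    apply: ge0_emeasurable_sum => // k x _; exact: abse_ge0.
  under eq_integral do rewrite gee0_abs ?nneseries_ge0//.
  exact: S_fin.
have := integrable_ae measurableT iS; apply: filterS => x /(_ I) Sx.
suff : cvgn (series (telescope (u ^~ x))).
  move=> h; have -> : u ^~ x = (fun n => u 0%N x + series (telescope (u ^~ x)) n).
    by apply/funext => n; rewrite -(eq_sum_telescope (u ^~ x)).
  by apply: is_cvgD => //; exact: is_cvg_cst.
apply: normed_cvg; apply: nondecreasing_is_cvgn.
  by apply: nondecreasing_series => n _ _; exact: normr_ge0.
exists (fine (S x)) => _ [n _ <-].
rewrite -lee_fin fineK// /series /= -sumEFin.
by apply: nneseries_lim_ge.
Qed.

(** The increments of [u] are absolutely summable almost everywhere, so [u]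
    converges almost everywhere; Fatou's lemma then bounds the distance from
    [u k] to the limit. *)
Theorem riesz_fischer : exists2 v : T -> R, measurable_fun [set: T] v &
  forall k, (\int[P]_x ((v x - u k x) ^+ 2)%:E <= (4 ^- k)%:E)%E.
Proof.
(* The upper limit is measurable without a case analysis on convergence. *)
pose v x := fine (limn_esup (fun k => (u k x)%:E)).
have mv : measurable_fun [set: T] v.
  apply: measurableT_comp => //; apply: measurable_fun_limn_esup => k.
  exact/measurable_EFinP.
exists v => // k.
have u_v : {ae P, forall x, u ^~ x @ \oo --> v x}.
  apply: filterS cvg_ae => x /cvg_ex[l ul].
  have /cvg_limn_einf_sup[_ lim_u] : (fun k => (u k x)%:E) @ \oo --> l%:E.
    by apply: cvg_EFin ul; exact: nearW.
  by rewrite /v lim_u.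
pose F n x := ((u (n + k)%N x - u k x) ^+ 2)%:E.
have mvu : measurable_fun [set: T] (fun x => ((v x - u k x) ^+ 2)%:E).
  by apply/measurable_EFinP; apply: measurable_funX; exact: measurable_funB.
have -> : (\int[P]_x ((v x - u k x) ^+ 2)%:E =
           \int[P]_x limn_einf (F ^~ x))%E.
  apply: ge0_ae_eq_integral => //.
  - apply: measurableT_comp => //; apply: measurable_fun_limn_esup => n.
    by apply: measurableT_comp => //; exact: mB2.
  - by move=> x _; rewrite lee_fin sqr_ge0.
  - move=> x _; rewrite limn_einf_lim; apply: lime_ge; first exact: is_cvg_einfs.
    apply: nearW => n; apply: le_ereal_inf_tmp => _ [m _ <-].
    by rewrite lee_fin sqr_ge0.
  - apply: filterS u_v => x ux _.
    apply/esym.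
    suff /cvg_limn_einf_sup[] : F ^~ x @ \oo --> ((v x - u k x) ^+ 2)%:E by [].
    apply: cvg_EFin; first exact: nearW.
    rewrite /comp /=; apply: (@cvg_comp _ _ _ _ (fun t : R => t ^+ 2)).
      have ux' : u (n + k)%N x @[n --> \oo] --> v x.
        by have := ux; rewrite -(cvg_shiftn k).
      by apply: cvgB; [exact: ux'|exact: cvg_cst].
    exact: exprn_continuous.
have F0 n x : [set: T] x -> (0 <= F n x)%E by rewrite lee_fin sqr_ge0.
apply: (le_trans (fatou P measurableT (fun n => mB2 _ _) F0)).
rewrite limn_einf_lim; apply: lime_le; first exact: is_cvg_einfs.
apply: nearW => n.
apply: (@le_trans _ _ (\int[P]_x F n x)%E); last exact/u_cauchy/leq_addl.
by apply: ereal_inf_lbound; exists n => /=.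
Qed.

End RieszFischer.

Section Projection.
Variable R : realType.
Local Notation T := (circle R).
Local Notation C := R[i].
Local Notation mu := (@circle_measure R).
Local Notation Re := (@complex.Re R).
Local Notation Im := (@complex.Im R).
Implicit Types (f g h x y : T -> C) (z : T).

Lemma sqnormE f : L2 f -> (sqnorm f)%:E = (\int[mu]_z (normsq (f z))%:E)%E.
Proof.
by move=> /L2P[_ If]; rewrite /sqnorm fineK//; exact: integrable_fin_num If.
Qed.

Lemma L2_complete (r : nat -> T -> C) : (forall k, L2 (r k)) ->
  (forall k j, (k <= j)%N -> sqnorm (r j \- r k) <= 4 ^- k) ->
  exists2 v, L2 v & forall k, sqnorm (v \- r k) <= 2 * 4 ^- k.
Proof.
move=> Lr cr.
have mr k : cmeasurable (r k) by exact: L2_measurable.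
have bound (p : C -> R) : (forall a b, p (a - b) = p a - p b) ->
    (forall a, p a ^+ 2 <= normsq a) ->
    (forall k, measurable_fun [set: T] (fun z => p (r k z))) ->
    exists2 v : T -> R, measurable_fun [set: T] v &
      forall k, (\int[mu]_z ((v z - p (r k z)) ^+ 2)%:E <= (4 ^- k)%:E)%E.
  move=> pB ple mp; apply: riesz_fischer => // k j kj.
  apply: (@le_trans _ _ (sqnorm (r j \- r k))%:E); last by rewrite lee_fin cr.
  rewrite sqnormE; last exact: L2B.
  apply: ge0_le_integral => //.
  - by move=> z _; rewrite lee_fin sqr_ge0.
  - by apply: measurable_EFin; apply: measurable_funX; exact: measurable_funB.
  - apply: measurable_EFin; apply: measurable_normsq; apply: L2_measurable.
    exact: L2B.
  - by move=> z _; rewrite lee_fin -pB ple.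
have [vr mvr Hr] : exists2 v : T -> R, measurable_fun [set: T] v &
    forall k, (\int[mu]_z ((v z - Re (r k z)) ^+ 2)%:E <= (4 ^- k)%:E)%E.
  apply: bound => [a b|a|k]; first by rewrite ReD ReN.
    by rewrite lerDl sqr_ge0.
  exact: (mr k).1.
have [vi mvi Hi] : exists2 v : T -> R, measurable_fun [set: T] v &
    forall k, (\int[mu]_z ((v z - Im (r k z)) ^+ 2)%:E <= (4 ^- k)%:E)%E.
  apply: bound => [a b|a|k]; first by rewrite ImD ImN.
    by rewrite lerDr sqr_ge0.
  exact: (mr k).2.
pose v z : C := vr z +i* vi z.
have le_v k : (\int[mu]_z (normsq (v z - r k z))%:E <= (2 * 4 ^- k)%:E)%E.
  have -> : (fun z => (normsq (v z - r k z))%:E) =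
      (fun z => ((vr z - Re (r k z)) ^+ 2)%:E + ((vi z - Im (r k z)) ^+ 2)%:E)%E.
    by apply/funext => z; rewrite /normsq ReD ImD ReN ImN EFinD.
  rewrite ge0_integralD//.
  - by rewrite mulr_natl mulr2n EFinD leeD.
  - by move=> z _; rewrite lee_fin sqr_ge0.
  - apply: measurable_EFin; apply: measurable_funX; apply: measurable_funB => //.
    exact: (mr k).1.
  - by move=> z _; rewrite lee_fin sqr_ge0.
  - apply: measurable_EFin; apply: measurable_funX; apply: measurable_funB => //.
    exact: (mr k).2.
have Lvr k : L2 (v \- r k).
  have m : cmeasurable (v \- r k).
    split.
    - under eq_fun do rewrite /= ReD ReN.
      by apply: measurable_funB => //; exact: (mr k).1.
    - under eq_fun do rewrite /= ImD ImN.
      by apply: measurable_funB => //; exact: (mr k).2.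
  apply/L2P; split=> //; apply/integrableP; split.
    by apply: measurable_EFin; exact: measurable_normsq.
  under eq_integral do rewrite abse_EFin ger0_norm ?normsq_ge0//.
  by apply: (le_lt_trans (le_v k)); rewrite ltry.
exists v.
  have := L2D (Lvr 0%N) (Lr 0%N); congr L2.
  by apply/funext => z /=; rewrite subrK.
by move=> k; rewrite -lee_fin sqnormE//; exact: le_v.
Qed.

Let e n : T -> C := zpow (- n.+1%:Z).

(** [residual x n] is [x] minus the Fourier terms of index [-1] to [-n]. These
    functions converge in L2 to the projection of [x] onto H2. *)
Fixpoint residual x n : T -> C :=
  if n is n'.+1 then
    residual x n' \- (fun z => inner (residual x n') (e n') * e n' z)
  else x.

Let Le n : L2 (e n). Proof. exact: L2_zpow. Qed.

Let ee m n : inner (e m) (e n) = (m == n)%:R.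
Proof. by rewrite inner_zpow eqr_opp eqz_nat eqSS. Qed.

Lemma L2_residual x n : L2 x -> L2 (residual x n).
Proof. by move=> Lx; elim: n => [//|n IH]; exact: (L2B IH (L2Z _ (Le n))). Qed.

Lemma residual_orthogonal x n m : L2 x -> (m < n)%N ->
  inner (residual x n) (e m) = 0.
Proof.
move=> Lx; elim: n => // n IH; have Lr := L2_residual n Lx.
rewrite ltnS leq_eqVlt [residual x n.+1]/= (innerBl Lr (L2Z _ (Le n)) (Le m)).
rewrite (innerZl _ (Le n) (Le m)) ee.
by case: eqVneq => [->|_ /= /IH->]; rewrite ?eqxx ?mulr1 ?mulr0 subrr.
Qed.

Lemma residual_H2 x n h : L2 x -> H2 h -> inner (residual x n) h = inner x h.
Proof.
move=> Lx [Lh hh]; elim: n => [//|n IH]; have Lr := L2_residual n Lx.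
rewrite [residual x n.+1]/= (innerBl Lr (L2Z _ (Le n)) Lh) (innerZl _ (Le n) Lh).
have he : inner h (e n) = 0 by rewrite -fourier_coefE hh.
by rewrite (innerC Lh (Le n)) he conjC0 mulr0 subr0.
Qed.

Lemma inner_residual x k j : L2 x -> (k <= j)%N ->
  inner (residual x j) (residual x k) = (sqnorm (residual x j))%:C.
Proof.
move=> Lx; have Lr n := L2_residual n Lx.
move=> kj; rewrite -(subnK kj); move: (j - k)%N => i {kj}.
elim: i k => [|i IH] k.
  by rewrite innerff.
have o : inner (residual x (i + k.+1)) (e k) = 0.
  by apply: residual_orthogonal; rewrite // addnS ltnS leq_addl.
rewrite addSnnS -IH [residual x k.+1]/= (innerBr (Lr k) (L2Z _ (Le k)) (Lr _)).
by rewrite (innerZr _ (Le k) (Lr _)) o mulr0 subr0.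
Qed.

Lemma sqnorm_residualB x k j : L2 x -> (k <= j)%N ->
  sqnorm (residual x j \- residual x k) =
  sqnorm (residual x k) - sqnorm (residual x j).
Proof.
move=> Lx kj; have Lr n := L2_residual n Lx.
rewrite sqnormB// inner_residual//=; ring.
Qed.

(** The squared norms of the residuals decrease, and their differences are the
    squared distances between residuals. *)
Lemma residual_subsequence x : L2 x -> exists M : nat -> nat,
  (forall k, (k <= M k)%N) /\ forall k j, (k <= j)%N ->
    sqnorm (residual x (M j) \- residual x (M k)) <= 4 ^- k.
Proof.
move=> Lx; pose a n := sqnorm (residual x n).
have a_noninc m n : (m <= n)%N -> a n <= a m.
  by move=> mn; rewrite -subr_ge0 -sqnorm_residualB// sqnorm_ge0.
have inf_a : has_inf (range a).
  by split; [exists (a 0%N), 0%N|exists 0 => _ [n _ <-]; exact: sqnorm_ge0].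
have /choice[N HN] k : exists n, a n < inf (range a) + 4 ^- k.
  have e0 : 0 < 4 ^- k :> R by rewrite invr_gt0 exprn_gt0.
  by have [_ [n _ <-] h] := inf_adherent e0 inf_a; exists n.
(* The sum makes [M] nondecreasing, and the summand [k] makes it unbounded. *)
pose M k := (k + \sum_(i < k.+1) N i)%N.
have MN k : (N k <= M k)%N.
  by rewrite /M big_ord_recr /= addnA leq_addl.
have Mhomo k j : (k <= j)%N -> (M k <= M j)%N.
  move=> kj; rewrite /M leq_add// -(subnK kj) -addnS addnC.
  by rewrite big_split_ord /= leq_addr.
exists M; split=> [k|k j kj]; first exact: leq_addr.
rewrite sqnorm_residualB//; last exact: Mhomo.
have h1 : inf (range a) <= a (M j) by apply: ge_inf; [case: inf_a|exists (M j)].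
have h2 := le_lt_trans (a_noninc _ _ (MN k)) (HN k).
by rewrite -/(a _) -/(a _); lra.
Qed.

(** In the limit, the residuals become orthogonal to every [z ^ n] with
    [n < 0], while their inner products with elements of H2 never change. *)
Theorem H2_projection_exists x : L2 x ->
  exists y, H2 y /\ forall h, H2 h -> inner (x \- y) h = 0.
Proof.
move=> Lx; have [M [kM cM]] := residual_subsequence Lx.
have Lr n := L2_residual n Lx.
have [v Lv vr] := L2_complete (fun k => Lr (M k)) cM.
have limv h a K : L2 h ->
    (forall k, (K <= k)%N -> inner (residual x (M k)) h = a) -> inner v h = a.
  move=> Lh ha; apply: sqnorm_le_inner_cvg => // eps eps0.
  have : 2 * 4 ^- k @[k --> \oo] --> (2 * 0 : R).
    apply: cvgMr; under eq_fun do rewrite -exprVn.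
    by apply: cvg_expr; rewrite ger0_norm// invf_lt1// ltr1n.
  rewrite mulr0 => /cvgrPdist_lt/(_ eps eps0) near_eps.
  near \oo => k; exists (residual x (M k)); last first.
    by apply: ha; near: k; exact: nbhs_infty_ge.
  split=> //; apply: (le_trans (vr k)); near: k.
  apply: filterS near_eps => k; rewrite sub0r normrN => /ltW.
  by apply: le_trans; exact: ler_norm.
exists v; split.
  split=> // n n0; rewrite fourier_coefE.
  case: n n0 => // n _; rewrite NegzE -/(e n).
  apply: (limv _ _ n.+1) => // k nk; apply: residual_orthogonal => //.
  exact: leq_trans nk (kM k).
move=> h Hh; have [Lh _] := Hh; rewrite innerBl//.
rewrite (limv h (inner x h) 0%N) ?subrr// => k _.
exact: residual_H2.
Unshelve. all: by end_near. Qed.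

End Projection.

(** * The Hardy space and its projection *)

Section HardySpace.
Variable R : realType.
Local Notation T := (circle R).
Local Notation C := R[i].
Local Notation mu := (@circle_measure R).
Local Notation Re := (@complex.Re R).
Implicit Types (f g h x y a b w phi psi : T -> C) (z : T) (n : int) (c : C).

Definition H2perp x := L2 x /\ forall h, H2 h -> inner x h = 0.

Lemma H2_L2 h : H2 h -> L2 h. Proof. by case. Qed.
Lemma H2perp_L2 y : H2perp y -> L2 y. Proof. by case. Qed.

Lemma H2D f g : H2 f -> H2 g -> H2 (f \+ g).
Proof.
move=> [Lf hf] [Lg hg]; split=> [|n n0]; first exact: L2D.
by rewrite fourier_coefD// hf// hg// addr0.
Qed.

Lemma H2B f g : H2 f -> H2 g -> H2 (f \- g).
Proof.
move=> [Lf hf] [Lg hg]; split=> [|n n0]; first exact: L2B.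
rewrite fourier_coefE innerBl//; last exact: L2_zpow.
by rewrite -!fourier_coefE hf// hg// subrr.
Qed.

Lemma H2perpD f g : H2perp f -> H2perp g -> H2perp (f \+ g).
Proof.
move=> [Lf hf] [Lg hg]; split=> [|h Hh]; first exact: L2D.
by rewrite innerDl ?hf ?hg ?addr0//; exact: H2_L2.
Qed.

Lemma fourier_coef_zpow m n : fourier_coef (@zpow R m) n = (m == n)%:R.
Proof. by rewrite fourier_coefE inner_zpow. Qed.

Lemma H2_zpow n : 0 <= n -> H2 (@zpow R n).
Proof.
move=> n0; split=> [|m m0]; first exact: L2_zpow.
by rewrite fourier_coef_zpow; case: eqVneq => // nm; move: n0; rewrite nm leNgt m0.
Qed.

Lemma H2perp_fourier_coef x n : H2perp x -> 0 <= n -> fourier_coef x n = 0.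
Proof. by move=> [_ xH] /H2_zpow /xH; rewrite fourier_coefE. Qed.

Lemma PplusP x : L2 x -> H2 (Pplus x) /\ H2perp (Pminus x).
Proof.
move=> Lx; have [y hy] := H2_projection_exists Lx.
have [HP hP] : [set y : T -> C | H2 y /\ forall h, H2 h -> inner (x \- y) h = 0]
  (Pplus x) by apply: xgetPex; exists y.
exact: (conj HP (conj (L2B Lx (H2_L2 HP)) hP)).
Qed.

Lemma H2_Pplus x : L2 x -> H2 (Pplus x). Proof. by case/PplusP. Qed.
Lemma H2perp_Pminus x : L2 x -> H2perp (Pminus x). Proof. by case/PplusP. Qed.
Lemma L2_Pplus x : L2 x -> L2 (Pplus x). Proof. by move/H2_Pplus/H2_L2. Qed.
Lemma L2_Pminus x : L2 x -> L2 (Pminus x).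
Proof. by move/H2perp_Pminus/H2perp_L2. Qed.

#[local] Opaque L2 Linfty Pplus.

Lemma inner_Pplus_Pminus a b : L2 a -> L2 b -> inner (Pplus a) (Pminus b) = 0.
Proof.
move=> La Lb; rewrite (innerC (L2_Pminus Lb) (L2_Pplus La)).
by rewrite (H2perp_Pminus Lb).2 ?conjC0//; exact: H2_Pplus.
Qed.

Lemma PplusDPminus x : x = Pplus x \+ Pminus x.
Proof. by apply/funext => z; rewrite /Pminus /= addrC subrK. Qed.

Lemma inner_Pplus a b : L2 a -> L2 b -> inner (Pplus a) b = inner a (Pplus b).
Proof.
move=> La Lb; have LPa := L2_Pplus La; have LPb := L2_Pplus Lb.
have LQa := L2_Pminus La; have LQb := L2_Pminus Lb.
rewrite [in LHS](PplusDPminus b) innerDr// inner_Pplus_Pminus// addr0.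
rewrite [in RHS](PplusDPminus a) innerDl// (H2perp_Pminus La).2 ?addr0//.
exact: H2_Pplus.
Qed.

Lemma inner_Pminus a b : L2 a -> L2 b -> inner (Pminus a) b = inner a (Pminus b).
Proof.
move=> La Lb; rewrite innerBl ?innerBr ?inner_Pplus//; exact: L2_Pplus.
Qed.

Lemma Pplus_unique x y : L2 x -> H2 y -> H2perp (x \- y) -> Pplus x = y %[ae mu].
Proof.
move=> Lx Hy [_ Qy]; have Ly := H2_L2 Hy; have LP := L2_Pplus Lx.
have Hd : H2 (Pplus x \- y) by apply: H2B => //; exact: H2_Pplus.
have Ld := H2_L2 Hd.
have : sqnorm (Pplus x \- y) = 0.
  have : inner (Pplus x \- y) (Pplus x \- y) = 0.
    rewrite [X in inner X _](_ : _ = (x \- y) \- Pminus x).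
      rewrite innerBl ?Qy ?(H2perp_Pminus Lx).2 ?subrr//; first exact: L2B.
      exact: L2_Pminus.
    by apply/funext => z; rewrite /Pminus /=; ring.
  by rewrite innerff// => /(congr1 Re).
move/(sqnorm_eq0 Ld); apply: filterS => z /= h /h /eqP.
by rewrite subr_eq0 => /eqP.
Qed.

Lemma Pminus_unique x y : L2 x -> H2 y -> H2perp (x \- y) ->
  Pminus x = x \- y %[ae mu].
Proof.
move=> Lx Hy Qy; have := Pplus_unique Lx Hy Qy.
by apply: filterS => z /= h /h; rewrite /Pminus /= => ->.
Qed.

(** Membership in H2 is defined by negative coefficients; by uniqueness of
    Fourier coefficients, its orthocomplement is likewise described by the
    nonnegative ones: the projection of such an [x] has no coefficient left. *)
Lemma H2perp_of_fourier_coef x :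
  L2 x -> (forall n, 0 <= n -> fourier_coef x n = 0) ->
  H2perp x.
Proof.
move=> Lx x0; split=> // h Hh; have LP := L2_Pplus Lx; have Lh := H2_L2 Hh.
have P0 : Pplus x = (fun=> 0) %[ae mu].
  apply: fourier_null_ae; split=> // n.
  have [n0|n0] := ltP n 0; first by rewrite (H2_Pplus Lx).2.
  have := x0 n n0; rewrite {1}(PplusDPminus x) fourier_coefD//; last exact: L2_Pminus.
  by rewrite (H2perp_fourier_coef (H2perp_Pminus Lx) n0) addr0.
rewrite (PplusDPminus x) innerDl//; last exact: L2_Pminus.
rewrite (H2perp_Pminus Lx).2// addr0 (inner_ael LP (L2_cst 0) Lh P0).
exact: inner0l.
Qed.

Lemma H2_ZM n h : 0 <= n -> H2 h -> H2 (zpow n \* h).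
Proof.
move=> n0 [Lh hh]; split=> [|m m0]; first exact: L2_zpowM.
by rewrite fourier_coef_zpowM hh// subr_lt0 (lt_le_trans m0).
Qed.

Lemma fourier_coefJ f n : L2 f -> fourier_coef (conjf f) n = (fourier_coef f (- n))^*.
Proof.
move=> Lf; rewrite !fourier_coefE -innerC//; last exact: L2_zpow.
rewrite -conjf_zpow; congr cintegral; apply/funext => z /=.
by rewrite mulrC.
Qed.

(** The coefficient of index [n < 0] of [phi h] is the inner product of [h]
    with a function that has only negative coefficients. *)
Lemma Hinfty_mulH2 phi h : Hinfty phi -> H2 h -> H2 (phi \* h).
Proof.
move=> [Lphi [Lphi2 cphi]] Hh; have Lh := H2_L2 Hh.
split=> [|n n0]; first exact: L2M.
have Lc : L2 (conjf phi \* zpow n).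
  by apply: L2M; [exact: LinftyJ|exact: L2_zpow].
rewrite fourier_coefE inner_mull innerC // (H2perp_of_fourier_coef Lc _).2 ?conjC0//.
move=> m m0; rewrite [X in fourier_coef X](_ : _ = zpow n \* conjf phi); last first.
  by apply/funext => z /=; rewrite mulrC.
rewrite fourier_coef_zpowM fourier_coefJ// opprB cphi ?conjC0//.
by rewrite subr_lt0 (lt_le_trans n0).
Qed.

Lemma conjfK f : conjf (conjf f) = f.
Proof. by apply/funext => z; rewrite /conjf conjCK. Qed.

Lemma Hinfty_mulH2perp psi y : Hinfty (conjf psi) -> H2perp y -> H2perp (psi \* y).
Proof.
move=> Hpsi [Ly hy]; have Lpsi : Linfty psi.
  by have [/LinftyJ] := Hpsi; rewrite conjfK.
split=> [|h Hh]; first exact: L2M.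
by rewrite inner_mull hy//; exact: Hinfty_mulH2.
Qed.

Lemma VopE x : Vop x = conjf (zpow 1 \* x).
Proof. by apply/funext => z; rewrite /Vop /conjf /= zpow1 conjcM. Qed.

Lemma L2_Vop x : L2 x -> L2 (Vop x).
Proof. by move=> Lx; rewrite VopE; exact/L2J/L2_zpowM. Qed.

Lemma fourier_coef_Vop x n : L2 x ->
  fourier_coef (Vop x) n = (fourier_coef x (- n - 1))^*.
Proof.
move=> Lx; rewrite VopE (fourier_coefJ n (L2_zpowM 1 Lx)).
by rewrite fourier_coef_zpowM.
Qed.

Lemma Vop_H2 x : H2 x -> H2perp (Vop x).
Proof.
move=> [Lx hx]; apply: H2perp_of_fourier_coef => [|n n0]; first exact: L2_Vop.
by rewrite fourier_coef_Vop// hx ?conjC0//; lia.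
Qed.

Lemma Vop_H2perp x : H2perp x -> H2 (Vop x).
Proof.
move=> Qx; have Lx := H2perp_L2 Qx; split=> [|n n0]; first exact: L2_Vop.
by rewrite fourier_coef_Vop// (H2perp_fourier_coef Qx) ?conjC0//; lia.
Qed.

Lemma fourier_coef_Pplus a n : L2 a -> 0 <= n ->
  fourier_coef (Pplus a) n = fourier_coef a n.
Proof.
move=> La n0; rewrite [in RHS](PplusDPminus a) fourier_coefD//.
- by rewrite (H2perp_fourier_coef (H2perp_Pminus La) n0) addr0.
- exact: L2_Pplus.
- exact: L2_Pminus.
Qed.

(* The backward shift: [z^-1 P a] fails to be in H2 only because of its
   coefficient of index [-1], which is [a_0]. *)
Let shift_parts a : L2 a ->
  let y := zpow (-1) \* (Pplus a \- (fun z => fourier_coef a 0 * zpow 0 z)) in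
  H2 y /\ H2perp (zpow (-1) \* a \- y).
Proof.
move=> La y; have Lz := @L2_zpowM R.
have LPa := L2_Pplus La; have LQa := L2_Pminus La.
have Lc c : L2 (fun z => c * @zpow R 0 z) by apply: L2Z; exact: L2_zpow.
have cst_coef c n : fourier_coef (fun z => c * @zpow R 0 z) n = c * (0 == n)%:R.
  by rewrite fourier_coefZ ?fourier_coef_zpow//; exact: L2_zpow.
split.
  split=> [|n n0]; first by apply: Lz; exact: L2B.
  rewrite fourier_coef_zpowM opprK fourier_coefE innerBl//; last exact: L2_zpow.
  rewrite -!fourier_coefE cst_coef.
  have [n1|n1] := eqVneq 0 (n + 1).
    by rewrite -n1 fourier_coef_Pplus// mulr1 subrr.
  by rewrite (H2_Pplus La).2 ?mulr0 ?subrr//; lia.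
have -> : zpow (-1) \* a \- y =
    zpow (-1) \* (Pminus a \+ (fun z => fourier_coef a 0 * zpow 0 z)).
  by apply/funext => z; rewrite /y /Pminus /=; ring.
apply: H2perp_of_fourier_coef => [|n n0]; first by apply: Lz; exact: L2D.
rewrite fourier_coef_zpowM opprK fourier_coefD// cst_coef.
rewrite (H2perp_fourier_coef (H2perp_Pminus La)); last lia.
by rewrite add0r (_ : 0 == _ = false) ?mulr0//; lia.
Qed.

Lemma inner_zpowM n a b : inner (zpow n \* a) (zpow n \* b) = inner a b.
Proof.
rewrite inner_mull conjf_zpow; congr inner; apply/funext => z /=.
by rewrite mulrA -zpowD addNr zpow0 mul1r.
Qed.

(** [Pplus] and [Pminus] fail to commute with multiplication by [z^-1] by
    operators of rank one, of opposite signs. *)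
Lemma inner_Pplus_shift a b : L2 a -> L2 b ->
  inner (Pplus (zpow (-1) \* a)) (zpow (-1) \* b) =
  inner (Pplus a) b - fourier_coef a 0 * (fourier_coef b 0)^*.
Proof.
move=> La Lb; have Lz := @L2_zpowM R.
have [Hy Qy] := shift_parts La.
rewrite (inner_ael _ (H2_L2 Hy) _ (Pplus_unique _ Hy Qy)); try exact: Lz; last first.
  exact/L2_Pplus/Lz.
rewrite inner_zpowM innerBl ?innerZl//; try exact: L2_zpow.
- by rewrite (innerC Lb (L2_zpow R 0)) !fourier_coefE.
- exact: L2_Pplus.
- by apply: L2Z; exact: L2_zpow.
Qed.

Lemma inner_Pminus_shift a b : L2 a -> L2 b ->
  inner (Pminus (zpow (-1) \* a)) (zpow (-1) \* b) =
  inner (Pminus a) b + fourier_coef a 0 * (fourier_coef b 0)^*.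
Proof.
move=> La Lb; have Lz := @L2_zpowM R.
have Lza := Lz (-1) a La; have Lzb := Lz (-1) b Lb.
have -> : inner (Pminus (zpow (-1) \* a)) (zpow (-1) \* b) =
    inner (zpow (-1) \* a) (zpow (-1) \* b) -
    inner (Pplus (zpow (-1) \* a)) (zpow (-1) \* b).
  exact: (innerBl Lza (L2_Pplus Lza) Lzb).
have -> : inner (Pminus a) b = inner a b - inner (Pplus a) b.
  exact: (innerBl La (L2_Pplus La) Lb).
by rewrite inner_zpowM (inner_Pplus_shift La Lb) opprB addrA addrAC.
Qed.

Lemma Pplus_shift a : L2 a -> fourier_coef a 0 = 0 ->
  Pplus (zpow (-1) \* a) = zpow (-1) \* Pplus a %[ae mu].
Proof.
move=> La a0; have [Hy Qy] := shift_parts La.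
have Lz := L2_zpowM (-1) La.
apply: filterS (Pplus_unique Lz Hy Qy) => z /= h /h.
by rewrite a0 mul0r subr0.
Qed.

Lemma Pminus_shift a : L2 a -> fourier_coef a 0 = 0 ->
  Pminus (zpow (-1) \* a) = zpow (-1) \* Pminus a %[ae mu].
Proof.
move=> La a0; apply: filterS (Pplus_shift La a0) => z /= h /h.
by rewrite /Pminus /= mulrBr => ->.
Qed.

End HardySpace.

(** * Generalized Cauchy singular integral operators *)

Section Gsio.
Variable R : realType.
Local Notation T := (circle R).
Local Notation C := R[i].
Local Notation mu := (@circle_measure R).
Implicit Types (f g h u v x y a b w phi psi : T -> C) (z : T) (n : int) (c : C).

Definition mulPQ phi psi x : T -> C := (phi \* Pplus x) \+ (psi \* Pminus x).

(** Exactly the pairs of bounded functions for which multiplication by [phi]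
    preserves H2 and multiplication by [psi] preserves its orthocomplement. *)
Definition Hinfty_pair phi psi := Hinfty phi /\ Hinfty (conjf psi).

#[local] Opaque L2 Linfty Pplus.

Lemma L2_mulPQ phi psi x : Linfty phi -> Linfty psi -> L2 x -> L2 (mulPQ phi psi x).
Proof.
by move=> Lphi Lpsi Lx; apply: L2D; apply: L2M => //; [exact: L2_Pplus|exact: L2_Pminus].
Qed.

Lemma inner_mulPQr phi psi w a : Linfty phi -> Linfty psi -> L2 w -> L2 a ->
  inner a (mulPQ phi psi w) =
  inner (conjf phi \* a) (Pplus w) + inner (conjf psi \* a) (Pminus w).
Proof.
move=> Lphi Lpsi Lw La.
have LPw := L2_Pplus Lw; have LQw := L2_Pminus Lw.
rewrite (innerDr (L2M Lphi LPw) (L2M Lpsi LQw) La) !inner_mull.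
by rewrite !conjfK.
Qed.

Lemma mulPQ_parts phi psi x : Hinfty_pair phi psi -> L2 x ->
  Pplus (mulPQ phi psi x) = mulPQ phi (fun=> 0) x %[ae mu] /\
  Pminus (mulPQ phi psi x) = mulPQ (fun=> 0) psi x %[ae mu].
Proof.
move=> [Hphi Hpsi] Lx.
have Lphi : Linfty phi by case: Hphi.
have Lpsi : Linfty psi by case: Hpsi => /LinftyJ; rewrite conjfK.
have LX := L2_mulPQ Lphi Lpsi Lx.
have Hy : H2 (phi \* Pplus x) by apply: Hinfty_mulH2 => //; exact: H2_Pplus.
have E : mulPQ phi psi x \- (phi \* Pplus x) = psi \* Pminus x.
  by apply/funext => z; rewrite /mulPQ /=; ring.
have Qy : H2perp (mulPQ phi psi x \- (phi \* Pplus x)).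
  by rewrite E; apply: Hinfty_mulH2perp => //; exact: H2perp_Pminus.
split.
- apply: filterS (Pplus_unique LX Hy Qy) => z h /h ->.
  by rewrite /mulPQ /= mul0r addr0.
- apply: filterS (Pminus_unique LX Hy Qy) => z h /h ->.
  by rewrite E /mulPQ /= mul0r add0r.
Qed.

Lemma inner_Pplus_mulPQ phi psi x b : Hinfty_pair phi psi -> L2 x -> L2 b ->
  inner (Pplus (mulPQ phi psi x)) b = inner (mulPQ phi (fun=> 0) x) b.
Proof.
move=> H Lx Lb; have [[Lphi _] [/LinftyJ]] := H; rewrite conjfK => Lpsi _.
exact: (inner_ael (L2_Pplus (L2_mulPQ Lphi Lpsi Lx))
  (L2_mulPQ Lphi (Linfty_cst 0) Lx) Lb (mulPQ_parts H Lx).1).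
Qed.

Lemma inner_Pminus_mulPQ phi psi x b : Hinfty_pair phi psi -> L2 x -> L2 b ->
  inner (Pminus (mulPQ phi psi x)) b = inner (mulPQ (fun=> 0) psi x) b.
Proof.
move=> H Lx Lb; have [[Lphi _] [/LinftyJ]] := H; rewrite conjfK => Lpsi _.
exact: (inner_ael (L2_Pminus (L2_mulPQ Lphi Lpsi Lx))
  (L2_mulPQ (Linfty_cst 0) Lpsi Lx) Lb (mulPQ_parts H Lx).2).
Qed.

Lemma L2_GSIO f u g v x : Linfty f -> Linfty u -> Linfty g -> Linfty v -> L2 x ->
  L2 (GSIO f u g v x).
Proof.
move=> Lf Lu Lg Lv Lx; have LP := L2_Pplus Lx; have LQ := L2_Pminus Lx.
have L1 := L2_Pplus (L2M Lf LP); have L2' := L2_Pminus (L2M Lg LP).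
have L3 := L2_Pplus (L2M Lu LQ); have L4 := L2_Pminus (L2M Lv LQ).
exact: (L2D (L2D (L2D L1 L2') L3) L4).
Qed.

Lemma inner_GSIO f u g v x w :
  Linfty f -> Linfty u -> Linfty g -> Linfty v -> L2 x -> L2 w ->
  inner (GSIO f u g v x) w =
  inner (mulPQ f u x) (Pplus w) + inner (mulPQ g v x) (Pminus w).
Proof.
move=> Lf Lu Lg Lv Lx Lw; have LP := L2_Pplus Lx; have LQ := L2_Pminus Lx.
have LPw := L2_Pplus Lw; have LQw := L2_Pminus Lw.
have L1 : L2 (f \* Pplus x) by exact: L2M.
have L2' : L2 (g \* Pplus x) by exact: L2M.
have L3 : L2 (u \* Pminus x) by exact: L2M.
have L4 : L2 (v \* Pminus x) by exact: L2M.
have LP1 := L2_Pplus L1; have LP3 := L2_Pplus L3.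
have LQ2 := L2_Pminus L2'; have LQ4 := L2_Pminus L4.
rewrite /mulPQ (innerDl L1 L3 LPw) (innerDl L2' L4 LQw).
rewrite -(inner_Pplus L1 Lw) -(inner_Pplus L3 Lw).
rewrite -(inner_Pminus L2' Lw) -(inner_Pminus L4 Lw) /GSIO.
have L12 := L2D LP1 LQ2; have L123 := L2D L12 LP3.
rewrite (innerDl L123 LQ4 Lw) (innerDl L12 LP3 Lw) (innerDl LP1 LQ2 Lw).
by rewrite -!addrA; congr (_ + _); rewrite addrCA.
Qed.

Lemma GSIO_parts f u g v x b :
  Linfty f -> Linfty u -> Linfty g -> Linfty v -> L2 x -> L2 b ->
  inner (Pplus (GSIO f u g v x)) b = inner (Pplus (mulPQ f u x)) b /\
  inner (Pminus (GSIO f u g v x)) b = inner (Pminus (mulPQ g v x)) b.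
Proof.
move=> Lf Lu Lg Lv Lx Lb; have LG := L2_GSIO Lf Lu Lg Lv Lx.
have LP := L2_Pplus Lx; have LQ := L2_Pminus Lx.
have L1 : L2 (f \* Pplus x) by exact: L2M.
have L2' : L2 (g \* Pplus x) by exact: L2M.
have L3 : L2 (u \* Pminus x) by exact: L2M.
have L4 : L2 (v \* Pminus x) by exact: L2M.
pose A := Pplus (f \* Pplus x) \+ Pplus (u \* Pminus x).
pose B := Pminus (g \* Pplus x) \+ Pminus (v \* Pminus x).
have HA : H2 A by apply: H2D; exact: H2_Pplus.
have EB : GSIO f u g v x \- A = B.
  by apply/funext => z; rewrite /GSIO /A /B /=; ring.
have HB : H2perp B by apply: H2perpD; exact: H2perp_Pminus.
have HGA : H2perp (GSIO f u g v x \- A) by rewrite EB.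
split.
- rewrite (inner_ael (L2_Pplus LG) (H2_L2 HA) Lb (Pplus_unique LG HA HGA)).
  rewrite (innerDl (L2_Pplus L1) (L2_Pplus L3) Lb).
  rewrite (inner_Pplus L1 Lb) (inner_Pplus L3 Lb).
  rewrite (inner_Pplus (L2_mulPQ Lf Lu Lx) Lb).
  exact: (esym (innerDl L1 L3 (L2_Pplus Lb))).
- have LB := H2perp_L2 HB.
  have EQ := Pminus_unique LG HA HGA; rewrite EB in EQ.
  rewrite (inner_ael (L2_Pminus LG) LB Lb EQ).
  rewrite (innerDl (L2_Pminus L2') (L2_Pminus L4) Lb).
  rewrite (inner_Pminus L2' Lb) (inner_Pminus L4 Lb).
  rewrite (inner_Pminus (L2_mulPQ Lg Lv Lx) Lb).
  exact: (esym (innerDl L2' L4 (L2_Pminus Lb))).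
Qed.

(** The basic formula for the product, which moves the symbols of the left
    factor to the other side of the inner product. *)
Lemma inner_GSIO_comp f1 u1 g1 v1 f2 u2 g2 v2 x w :
  Linfty f1 -> Linfty u1 -> Linfty g1 -> Linfty v1 ->
  Linfty f2 -> Linfty u2 -> Linfty g2 -> Linfty v2 -> L2 x -> L2 w ->
  inner ((GSIO f1 u1 g1 v1 \o GSIO f2 u2 g2 v2) x) w =
  inner (Pplus (mulPQ f2 u2 x)) (mulPQ (conjf f1) (conjf g1) w) +
  inner (Pminus (mulPQ g2 v2 x)) (mulPQ (conjf u1) (conjf v1) w).
Proof.
move=> Lf1 Lu1 Lg1 Lv1 Lf2 Lu2 Lg2 Lv2 Lx Lw /=.
have Ly := L2_GSIO Lf2 Lu2 Lg2 Lv2 Lx.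
have Lb : L2 (mulPQ (conjf f1) (conjf g1) w) by apply: L2_mulPQ => //; exact: LinftyJ.
have Lb' : L2 (mulPQ (conjf u1) (conjf v1) w) by apply: L2_mulPQ => //; exact: LinftyJ.
rewrite -(GSIO_parts Lf2 Lu2 Lg2 Lv2 Lx Lb).1 -(GSIO_parts Lf2 Lu2 Lg2 Lv2 Lx Lb').2.
set y := GSIO f2 u2 g2 v2 x in Ly *.
have LPy := L2_Pplus Ly; have LQy := L2_Pminus Ly.
have LPw := L2_Pplus Lw; have LQw := L2_Pminus Lw.
rewrite (inner_GSIO Lf1 Lu1 Lg1 Lv1 Ly Lw).
rewrite (inner_mulPQr (LinftyJ Lf1) (LinftyJ Lg1) Lw LPy).
rewrite (inner_mulPQr (LinftyJ Lu1) (LinftyJ Lv1) Lw LQy) !conjfK.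
rewrite (innerDl (L2M Lf1 LPy) (L2M Lu1 LQy) LPw).
rewrite (innerDl (L2M Lg1 LPy) (L2M Lv1 LQy) LQw).
exact: addrACA.
Qed.

End Gsio.

(** * Sufficiency of the conditions on the symbols *)

Section Forms.
Variable R : realType.
Local Notation T := (circle R).
Local Notation C := R[i].
Implicit Types (f g h u v x y a b w phi psi : T -> C) (z : T) (n : int) (c : C).

#[local] Opaque L2 Linfty Pplus inner GSIO.

(** The sesquilinear forms of the operators under study. Sums and multiples of
    such forms are again of this kind, so a product may be treated term by
    term. *)
Definition GSIO_form (B : (T -> C) -> (T -> C) -> C) :=
  exists f u g v, [/\ Linfty f, Linfty u, Linfty g & Linfty v] /\
    forall x w, L2 x -> L2 w ->
      B x w = inner (mulPQ f u x) (Pplus w) + inner (mulPQ g v x) (Pminus w).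

Lemma mulPQ_mull phi f u x : phi \* mulPQ f u x = mulPQ (phi \* f) (phi \* u) x.
Proof. by apply/funext => z; rewrite /mulPQ /= mulrDr !mulrA. Qed.

Lemma mulPQ_lin c f u f' u' x :
  mulPQ (f \+ (fun z => c * f' z)) (u \+ (fun z => c * u' z)) x =
  mulPQ f u x \+ (fun z => c * mulPQ f' u' x z).
Proof. by apply/funext => z; rewrite /mulPQ /=; ring. Qed.

Lemma GSIO_form_ext B B' : GSIO_form B ->
  (forall x w, L2 x -> L2 w -> B' x w = B x w) -> GSIO_form B'.
Proof.
move=> [f [u [g [v [L H]]]]] E; exists f, u, g, v; split=> // x w Lx Lw.
by rewrite E// H.
Qed.

Lemma GSIO_form_lin c B B' : GSIO_form B -> GSIO_form B' ->
  GSIO_form (fun x w => B x w + c * B' x w).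
Proof.
move=> [f [u [g [v [[Lf Lu Lg Lv] H]]]]] [f' [u' [g' [v' [[Lf' Lu' Lg' Lv'] H']]]]].
exists (f \+ (fun z => c * f' z)), (u \+ (fun z => c * u' z)).
exists (g \+ (fun z => c * g' z)), (v \+ (fun z => c * v' z)); split.
  split; [exact: (LinftyD Lf (LinftyZ c Lf'))|exact: (LinftyD Lu (LinftyZ c Lu'))|
          exact: (LinftyD Lg (LinftyZ c Lg'))|exact: (LinftyD Lv (LinftyZ c Lv'))].
move=> x w Lx Lw; rewrite H// H'// !mulPQ_lin.
have LPw := L2_Pplus Lw; have LQw := L2_Pminus Lw.
have L1 := L2_mulPQ Lf Lu Lx; have L1' := L2_mulPQ Lf' Lu' Lx.
have L3 := L2_mulPQ Lg Lv Lx; have L3' := L2_mulPQ Lg' Lv' Lx.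
rewrite (innerDl L1 (L2Z c L1') LPw) (innerDl L3 (L2Z c L3') LQw).
rewrite (innerZl c L1' LPw) (innerZl c L3' LQw).
by rewrite mulrDr addrACA.
Qed.

Lemma GSIO_form_mulPQ f u phi psi :
  Linfty f -> Linfty u -> Linfty phi -> Linfty psi ->
  GSIO_form (fun x w => inner (mulPQ f u x) (mulPQ phi psi w)).
Proof.
move=> Lf Lu Lphi Lpsi.
exists (conjf phi \* f), (conjf phi \* u), (conjf psi \* f), (conjf psi \* u); split.
  have LJphi := LinftyJ Lphi; have LJpsi := LinftyJ Lpsi.
  split; [exact: (LinftyM LJphi Lf)|exact: (LinftyM LJphi Lu)|
          exact: (LinftyM LJpsi Lf)|exact: (LinftyM LJpsi Lu)].
move=> x w Lx Lw.
by rewrite (inner_mulPQr Lphi Lpsi Lw (L2_mulPQ Lf Lu Lx)) !mulPQ_mull.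
Qed.

Definition product_form f1 u1 g1 v1 f2 u2 g2 v2 x w : C :=
  inner (Pplus (mulPQ f2 u2 x)) (mulPQ (conjf f1) (conjf g1) w) +
  inner (Pminus (mulPQ g2 v2 x)) (mulPQ (conjf u1) (conjf v1) w).

Lemma GSIO_of_form f1 u1 g1 v1 f2 u2 g2 v2 :
  Linfty f1 -> Linfty u1 -> Linfty g1 -> Linfty v1 ->
  Linfty f2 -> Linfty u2 -> Linfty g2 -> Linfty v2 ->
  GSIO_form (product_form f1 u1 g1 v1 f2 u2 g2 v2) ->
  exists f3 u3 g3 v3 : T -> C,
    [/\ Linfty f3, Linfty u3, Linfty g3 & Linfty v3] /\
    eq_L2op (GSIO f1 u1 g1 v1 \o GSIO f2 u2 g2 v2) (GSIO f3 u3 g3 v3).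
Proof.
move=> Lf1 Lu1 Lg1 Lv1 Lf2 Lu2 Lg2 Lv2 [f3 [u3 [g3 [v3 [[Lf3 Lu3 Lg3 Lv3] H]]]]].
exists f3, u3, g3, v3; split=> // x Lx.
have Ly := L2_GSIO Lf2 Lu2 Lg2 Lv2 Lx.
apply: inner_ext => [||w Lw].
- exact: L2_GSIO Lf1 Lu1 Lg1 Lv1 Ly.
- exact: L2_GSIO Lf3 Lu3 Lg3 Lv3 Lx.
transitivity (product_form f1 u1 g1 v1 f2 u2 g2 v2 x w).
  exact: (inner_GSIO_comp Lf1 Lu1 Lg1 Lv1 Lf2 Lu2 Lg2 Lv2 Lx Lw).
by rewrite (H x w Lx Lw) (inner_GSIO Lf3 Lu3 Lg3 Lv3 Lx Lw).
Qed.

Lemma Hinfty_pair_Linfty phi psi : Hinfty_pair phi psi -> Linfty phi /\ Linfty psi.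
Proof. by move=> [[Lphi _] [/LinftyJ]]; rewrite conjfK. Qed.

Lemma inner_Pplus_mulPQr phi psi w a : Hinfty_pair phi psi -> L2 w -> L2 a ->
  inner (Pplus a) (mulPQ phi psi w) = inner a (mulPQ phi (fun=> 0) w).
Proof.
move=> H Lw La; have [Lphi Lpsi] := Hinfty_pair_Linfty H.
have LX := L2_mulPQ Lphi Lpsi Lw.
have L0 := L2_mulPQ Lphi (Linfty_cst 0) Lw.
rewrite (inner_Pplus La LX) (innerC (L2_Pplus LX) La).
by rewrite (inner_Pplus_mulPQ H Lw La) -(innerC L0 La).
Qed.

Lemma inner_Pminus_mulPQr phi psi w a : Hinfty_pair phi psi -> L2 w -> L2 a ->
  inner (Pminus a) (mulPQ phi psi w) = inner a (mulPQ (fun=> 0) psi w).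
Proof.
move=> H Lw La; have [Lphi Lpsi] := Hinfty_pair_Linfty H.
have LX := L2_mulPQ Lphi Lpsi Lw.
have L0 := L2_mulPQ (Linfty_cst 0) Lpsi Lw.
rewrite (inner_Pminus La LX) (innerC (L2_Pminus LX) La).
by rewrite (inner_Pminus_mulPQ H Lw La) -(innerC L0 La).
Qed.

Section Product.
Variables f1 u1 g1 v1 f2 u2 g2 v2 : T -> C.
Hypotheses (Lf1 : Linfty f1) (Lu1 : Linfty u1) (Lg1 : Linfty g1) (Lv1 : Linfty v1).
Hypotheses (Lf2 : Linfty f2) (Lu2 : Linfty u2) (Lg2 : Linfty g2) (Lv2 : Linfty v2).

Let L0 : Linfty (fun=> 0 : C) := Linfty_cst 0.
Let LJf1 := LinftyJ Lf1.
Let LJu1 := LinftyJ Lu1.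
Let LJg1 := LinftyJ Lg1.
Let LJv1 := LinftyJ Lv1.

(** Each of the two terms of [product_form] loses its projection under the
    corresponding alternative. *)
Lemma split_product_form :
  Hinfty_pair (conjf f1) (conjf g1) \/ Hinfty_pair f2 u2 ->
  Hinfty_pair (conjf u1) (conjf v1) \/ Hinfty_pair g2 v2 ->
  GSIO_form (product_form f1 u1 g1 v1 f2 u2 g2 v2).
Proof.
move=> AB CD.
have FP : GSIO_form (fun x w =>
    inner (Pplus (mulPQ f2 u2 x)) (mulPQ (conjf f1) (conjf g1) w)).
  case: AB => [A|B].
  - apply: (GSIO_form_ext (GSIO_form_mulPQ Lf2 Lu2 LJf1 L0)) => x w Lx Lw.
    exact: (inner_Pplus_mulPQr A Lw (L2_mulPQ Lf2 Lu2 Lx)).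
  - apply: (GSIO_form_ext (GSIO_form_mulPQ Lf2 L0 LJf1 LJg1)) => x w Lx Lw.
    exact: (inner_Pplus_mulPQ B Lx (L2_mulPQ LJf1 LJg1 Lw)).
have FQ : GSIO_form (fun x w =>
    inner (Pminus (mulPQ g2 v2 x)) (mulPQ (conjf u1) (conjf v1) w)).
  case: CD => [C1|D].
  - apply: (GSIO_form_ext (GSIO_form_mulPQ Lg2 Lv2 L0 LJv1)) => x w Lx Lw.
    exact: (inner_Pminus_mulPQr C1 Lw (L2_mulPQ Lg2 Lv2 Lx)).
  - apply: (GSIO_form_ext (GSIO_form_mulPQ L0 Lv2 LJu1 LJv1)) => x w Lx Lw.
    exact: (inner_Pminus_mulPQ D Lx (L2_mulPQ LJu1 LJv1 Lw)).
apply: (GSIO_form_ext (GSIO_form_lin 1 FP FQ)) => x w _ _.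
by rewrite mul1r.
Qed.

(** Put [b = lambda^* b' + d] and [a' = lambda a + e], where multiplication by
    the symbols of [d] and [e] respects H2 and its orthocomplement. Then
    [<P a, b> + <Q a', b'> = <P a, d> + <a', b'> - <P e, b'>], because the
    terms [lambda <P a, b'>] cancel. *)
Lemma coupled_product_form lambda :
  Hinfty_pair (conjf f1 \+ (fun z => - lambda^* * conjf u1 z))
              (conjf g1 \+ (fun z => - lambda^* * conjf v1 z)) ->
  Hinfty_pair (g2 \+ (fun z => - lambda * f2 z))
              (v2 \+ (fun z => - lambda * u2 z)) ->
  GSIO_form (product_form f1 u1 g1 v1 f2 u2 g2 v2).
Proof.
move=> H1 H2; have [LF LG] := Hinfty_pair_Linfty H1.
have [LG2 LV2] := Hinfty_pair_Linfty H2.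
have F1 := GSIO_form_mulPQ Lf2 Lu2 LF L0.
have F2 := GSIO_form_mulPQ Lg2 Lv2 LJu1 LJv1.
have F3 := GSIO_form_mulPQ LG2 L0 LJu1 LJv1.
apply: (GSIO_form_ext (GSIO_form_lin (-1) (GSIO_form_lin 1 F1 F2) F3)) => x w Lx Lw.
have La := L2_mulPQ Lf2 Lu2 Lx; have La' := L2_mulPQ Lg2 Lv2 Lx.
have Lb := L2_mulPQ LJf1 LJg1 Lw; have Lb' := L2_mulPQ LJu1 LJv1 Lw.
rewrite -(inner_Pplus_mulPQr H1 Lw La) -(inner_Pplus_mulPQ H2 Lx Lb').
rewrite !mulPQ_lin /product_form.
set a := mulPQ f2 u2 x in La *; set a' := mulPQ g2 v2 x in La' *.
set b := mulPQ (conjf f1) _ w in Lb *; set b' := mulPQ (conjf u1) _ w in Lb' *.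
have LPa := L2_Pplus La.
have LPb' := L2_Pplus Lb'.
rewrite (innerDr Lb (L2Z _ Lb') LPa) (innerZr _ Lb' LPa).
have La2 := L2D La' (L2Z (- lambda) La).
rewrite (inner_Pplus La2 Lb') (innerDl La' (L2Z _ La) LPb') (innerZl _ La LPb').
have -> : inner (Pminus a') b' = inner a' b' - inner (Pplus a') b'.
  exact: (innerBl La' (L2_Pplus La') Lb').
rewrite (inner_Pplus La' Lb') (inner_Pplus La Lb') rmorphN /= conjCK.
ring.
Qed.

End Product.

End Forms.

(** * The columns of symbols as functionals *)

Section Functionals.
Variable R : realType.
Local Notation T := (circle R).
Local Notation C := R[i].
Local Notation mu := (@circle_measure R).
Implicit Types (f g h u v x y a b w phi psi : T -> C) (z : T) (n : int) (c : C).

#[local] Opaque L2 Linfty Pplus inner GSIO.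

(** These are the elements of L2 with zero coefficient of index 0, so that
    both [P] and [Q] commute with [z^-1] on them. *)
Definition glue x1 x2 : T -> C := (zpow 1 \* Pplus x1) \+ Pminus x2.

Lemma glue_parts x1 x2 : L2 x1 -> L2 x2 ->
  [/\ L2 (glue x1 x2), Pplus (glue x1 x2) = zpow 1 \* Pplus x1 %[ae mu] &
      Pminus (glue x1 x2) = Pminus x2 %[ae mu]].
Proof.
move=> L1 L2x.
have LG : L2 (glue x1 x2) := L2D (L2_zpowM 1 (L2_Pplus L1)) (L2_Pminus L2x).
have Hy : H2 (zpow 1 \* Pplus x1) := @H2_ZM R 1 _ isT (H2_Pplus L1).
have E : glue x1 x2 \- (zpow 1 \* Pplus x1) = Pminus x2.
  by apply/funext => z; rewrite /glue /= addrC addKr.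
have Qy : H2perp (glue x1 x2 \- (zpow 1 \* Pplus x1)).
  by rewrite E; exact: H2perp_Pminus.
split; [by []|exact: Pplus_unique LG Hy Qy|].
by have := Pminus_unique LG Hy Qy; rewrite E.
Qed.

Lemma fourier_coef_glue x1 x2 : L2 x1 -> L2 x2 -> fourier_coef (glue x1 x2) 0 = 0.
Proof.
move=> L1 L2x.
rewrite (fourier_coefD 0 (L2_zpowM 1 (L2_Pplus L1)) (L2_Pminus L2x)).
rewrite fourier_coef_zpowM (H2_Pplus L1).2//.
by rewrite (H2perp_fourier_coef (H2perp_Pminus L2x))// addr0.
Qed.

(** The functional represented by the column [symbol_vector phi psi]; this is
    how the columns of the theorem enter the proof. *)
Definition functional phi psi x1 x2 : C :=
  fourier_coef (mulPQ phi psi (glue x1 x2)) 0.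

Lemma functionalE phi psi x1 x2 : Linfty phi -> Linfty psi -> L2 x1 -> L2 x2 ->
  functional phi psi x1 x2 =
  fourier_coef (phi \* (zpow 1 \* Pplus x1)) 0 + fourier_coef (psi \* Pminus x2) 0.
Proof.
move=> Lphi Lpsi L1 L2x; have [LG EP EQ] := glue_parts L1 L2x.
have La := L2M Lphi (L2_zpowM 1 (L2_Pplus L1)).
have Lb := L2M Lpsi (L2_Pminus L2x).
rewrite -(fourier_coefD 0 La Lb).
apply: (fourier_coef_ae _ (L2_mulPQ Lphi Lpsi LG) (L2D La Lb)).
near=> z => _; rewrite /mulPQ /=; congr (_ * _ + _ * _).
  by near: z; apply: filterS EP => z; exact.
by near: z; apply: filterS EQ => z; exact.
Unshelve. all: by end_near. Qed.

Lemma functional_lin c phi psi phi' psi' x1 x2 :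
  Linfty phi -> Linfty psi -> Linfty phi' -> Linfty psi' -> L2 x1 -> L2 x2 ->
  functional (phi \+ (fun z => c * phi' z)) (psi \+ (fun z => c * psi' z)) x1 x2 =
  functional phi psi x1 x2 + c * functional phi' psi' x1 x2.
Proof.
move=> L1 L2' L3 L4 Lx1 Lx2; have [LG _ _] := glue_parts Lx1 Lx2.
have La := L2_mulPQ L1 L2' LG; have Lb := L2_mulPQ L3 L4 LG.
by rewrite /functional mulPQ_lin (fourier_coefD 0 La (L2Z c Lb)) (fourier_coefZ c 0 Lb).
Qed.

Definition symbol_vector phi psi : (T -> C) * (T -> C) :=
  (Vop (Pminus phi), Pminus (conjf psi)).

(** Since [V] exchanges H2 and its orthocomplement, only the part [P x1] of
    [x1] and only the part [Q phi] of [phi] contribute to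
    [<phi z P x1, 1> = <P x1, V phi>]. *)
Lemma inner2_symbol_vector phi psi x1 x2 :
  Linfty phi -> Linfty psi -> L2 x1 -> L2 x2 ->
  inner2 (x1, x2) (symbol_vector phi psi) = functional phi psi x1 x2.
Proof.
move=> Lphi Lpsi L1 L2x; rewrite functionalE// /inner2 /=; congr (_ + _).
- have Lp := Linfty_L2 Lphi.
  have LP1 := L2_Pplus L1; have LPp := L2_Pplus Lp; have LQp := L2_Pminus Lp.
  have HV := Vop_H2perp (H2perp_Pminus Lp).
  have LVP := L2_Vop LPp; have LVQ := L2_Vop LQp.
  rewrite {1}(PplusDPminus x1) (innerDl LP1 (L2_Pminus L1) LVQ).
  rewrite ((H2perp_Pminus L1).2 _ HV) addr0.
  have -> : inner (Pplus x1) (Vop (Pminus phi)) = inner (Pplus x1) (Vop phi).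
    have -> : Vop phi = Vop (Pplus phi) \+ Vop (Pminus phi).
      apply/funext => z; rewrite /Vop {1}(PplusDPminus phi) /=.
      by rewrite conjcD mulrDr.
    rewrite (innerDr LVP LVQ LP1) (innerC LVP LP1).
    by rewrite ((Vop_H2 (H2_Pplus Lp)).2 _ (H2_Pplus L1)) conjC0 add0r.
  rewrite fourier_coefE inner_mull inner_mull; congr inner.
  apply/funext => z; rewrite VopE /conjf /= zpow0 mulr1 rmorphM.
  by rewrite mulrC.
- rewrite -(inner_Pminus L2x (L2J (Linfty_L2 Lpsi))) fourier_coefE inner_mull.
  by congr inner; apply/funext => z; rewrite /= zpow0 mulr1.
Qed.

Lemma H2_of_Pminus phi : L2 phi -> Pminus phi = (fun=> 0) %[ae mu] -> H2 phi.
Proof.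
move=> Lp Q0; split=> // n n0; rewrite (PplusDPminus phi).
rewrite (fourier_coefD n (L2_Pplus Lp) (L2_Pminus Lp)) (H2_Pplus Lp).2// add0r.
rewrite (fourier_coef_ae n (L2_Pminus Lp) (L2_cst 0) Q0) fourier_coefE.
by rewrite inner0l//; exact: L2_zpow.
Qed.

Lemma functional_eq0P phi psi : Linfty phi -> Linfty psi ->
  (forall x1 x2, L2 x1 -> L2 x2 -> functional phi psi x1 x2 = 0) <->
  Hinfty_pair phi psi.
Proof.
move=> Lphi Lpsi; split=> [F0|[Hphi Hpsi] x1 x2 L1 L2x]; last first.
  rewrite functionalE//.
  have -> : phi \* (zpow 1 \* Pplus x1) = zpow 1 \* (phi \* Pplus x1).
    by apply/funext => z /=; ring.
  rewrite fourier_coef_zpowM (Hinfty_mulH2 Hphi (H2_Pplus L1)).2// add0r.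
  exact: (H2perp_fourier_coef (Hinfty_mulH2perp Hpsi (H2perp_Pminus L2x))).
have Lp := Linfty_L2 Lphi; have Lq := L2J (Linfty_L2 Lpsi).
have LV := L2_Vop (L2_Pminus Lp); have LQ := L2_Pminus Lq.
have L0 : L2 (fun=> 0 : C) := L2_cst 0.
split; split=> //; last 2 first.
- exact: LinftyJ.
- apply: H2_of_Pminus => //; apply: (inner_eq0P LQ) => h Lh.
  rewrite (innerC Lh LQ) -[inner h _]add0r -{1}(inner0l LV).
  have := inner2_symbol_vector Lphi Lpsi L0 Lh.
  by rewrite /inner2 /= F0// => ->; rewrite conjC0.
- apply: H2_of_Pminus => //.
  have : Vop (Pminus phi) = (fun=> 0) %[ae mu].
    apply: (inner_eq0P LV) => h Lh.
    rewrite (innerC Lh LV) -[inner h _]addr0 -{1}(inner0l LQ).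
    have := inner2_symbol_vector Lphi Lpsi Lh L0.
    by rewrite /inner2 /= F0// => ->; rewrite conjC0.
  apply: filterS => z h /h; rewrite /Vop => /eqP.
  by rewrite mulf_eq0 !conjC_eq0 (negbTE (circle_neq0 z)) => /eqP.
Qed.

End Functionals.

(** * The rank-one identity *)

Section Main.
Variable R : realType.
Local Notation T := (circle R).
Local Notation C := R[i].
Local Notation mu := (@circle_measure R).
Implicit Types (f g h u v x y a b w phi psi : T -> C) (z : T) (n : int) (c : C).

#[local] Opaque L2 Linfty Pplus inner GSIO.

Local Notation shift x := (zpow (-1) \* x).

Lemma mulPQ_shift phi psi x : L2 x -> fourier_coef x 0 = 0 ->
  mulPQ phi psi (shift x) = shift (mulPQ phi psi x) %[ae mu].
Proof.
move=> Lx x0; have EP := Pplus_shift Lx x0; have EQ := Pminus_shift Lx x0.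
near=> z => _; rewrite /mulPQ /=.
have -> : Pplus (shift x) z = (shift (Pplus x)) z.
  by near: z; apply: filterS EP => z; exact.
have -> : Pminus (shift x) z = (shift (Pminus x)) z.
  by near: z; apply: filterS EQ => z; exact.
by rewrite /=; ring.
Unshelve. all: by end_near. Qed.

(** Moving the backward shift out of both projections leaves the two rank-one
    terms that measure how far a product is from being invariant. *)
Lemma product_form_shift f1 u1 g1 v1 f2 u2 g2 v2 x w :
  Linfty f1 -> Linfty u1 -> Linfty g1 -> Linfty v1 ->
  Linfty f2 -> Linfty u2 -> Linfty g2 -> Linfty v2 ->
  L2 x -> L2 w -> fourier_coef x 0 = 0 -> fourier_coef w 0 = 0 ->
  product_form f1 u1 g1 v1 f2 u2 g2 v2 (shift x) (shift w) =
  product_form f1 u1 g1 v1 f2 u2 g2 v2 x w -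
    fourier_coef (mulPQ f2 u2 x) 0 *
      (fourier_coef (mulPQ (conjf f1) (conjf g1) w) 0)^* +
    fourier_coef (mulPQ g2 v2 x) 0 *
      (fourier_coef (mulPQ (conjf u1) (conjf v1) w) 0)^*.
Proof.
move=> Lf1 Lu1 Lg1 Lv1 Lf2 Lu2 Lg2 Lv2 Lx Lw x0 w0.
have Lzx := L2_zpowM (-1) Lx; have Lzw := L2_zpowM (-1) Lw.
have LJf1 := LinftyJ Lf1; have LJu1 := LinftyJ Lu1.
have LJg1 := LinftyJ Lg1; have LJv1 := LinftyJ Lv1.
have P phi psi phi' psi' : Linfty phi -> Linfty psi -> Linfty phi' -> Linfty psi' ->
    inner (Pplus (mulPQ phi psi (shift x))) (mulPQ phi' psi' (shift w)) =
    inner (Pplus (shift (mulPQ phi psi x))) (shift (mulPQ phi' psi' w)).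
  move=> L1 L2' L3 L4.
  have La := L2_mulPQ L1 L2' Lx; have Lza := L2_mulPQ L1 L2' Lzx.
  have Lb := L2_mulPQ L3 L4 Lw; have Lzb := L2_mulPQ L3 L4 Lzw.
  have Lsa := L2_zpowM (-1) La; have Lsb := L2_zpowM (-1) Lb.
  rewrite (inner_aer Lzb Lsb (L2_Pplus Lza) (mulPQ_shift _ _ Lw w0)).
  rewrite (inner_Pplus Lza Lsb) (inner_Pplus Lsa Lsb).
  exact: (inner_ael Lza Lsa (L2_Pplus Lsb) (mulPQ_shift _ _ Lx x0)).
have Q phi psi phi' psi' : Linfty phi -> Linfty psi -> Linfty phi' -> Linfty psi' ->
    inner (Pminus (mulPQ phi psi (shift x))) (mulPQ phi' psi' (shift w)) =
    inner (Pminus (shift (mulPQ phi psi x))) (shift (mulPQ phi' psi' w)).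
  move=> L1 L2' L3 L4.
  have La := L2_mulPQ L1 L2' Lx; have Lza := L2_mulPQ L1 L2' Lzx.
  have Lb := L2_mulPQ L3 L4 Lw; have Lzb := L2_mulPQ L3 L4 Lzw.
  have Lsa := L2_zpowM (-1) La; have Lsb := L2_zpowM (-1) Lb.
  rewrite (inner_aer Lzb Lsb (L2_Pminus Lza) (mulPQ_shift _ _ Lw w0)).
  rewrite (inner_Pminus Lza Lsb) (inner_Pminus Lsa Lsb).
  exact: (inner_ael Lza Lsa (L2_Pminus Lsb) (mulPQ_shift _ _ Lx x0)).
have EP := etrans (P _ _ _ _ Lf2 Lu2 LJf1 LJg1)
  (inner_Pplus_shift (L2_mulPQ Lf2 Lu2 Lx) (L2_mulPQ LJf1 LJg1 Lw)).
have EQ := etrans (Q _ _ _ _ Lg2 Lv2 LJu1 LJv1)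
  (inner_Pminus_shift (L2_mulPQ Lg2 Lv2 Lx) (L2_mulPQ LJu1 LJv1 Lw)).
apply: (etrans (congr2 +%R EP EQ)).
by rewrite /product_form addrACA addrA.
Qed.

Lemma inner_GSIO_shift f u g v x w :
  Linfty f -> Linfty u -> Linfty g -> Linfty v ->
  L2 x -> L2 w -> fourier_coef x 0 = 0 -> fourier_coef w 0 = 0 ->
  inner (GSIO f u g v (shift x)) (shift w) = inner (GSIO f u g v x) w.
Proof.
move=> Lf Lu Lg Lv Lx Lw x0 w0.
have Lzx := L2_zpowM (-1) Lx; have Lzw := L2_zpowM (-1) Lw.
have La := L2_mulPQ Lf Lu Lx; have Lza := L2_mulPQ Lf Lu Lzx.
have Lb := L2_mulPQ Lg Lv Lx; have Lzb := L2_mulPQ Lg Lv Lzx.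
have LPw := L2_zpowM (-1) (L2_Pplus Lw); have LQw := L2_zpowM (-1) (L2_Pminus Lw).
have EP : inner (mulPQ f u (shift x)) (Pplus (shift w)) =
    inner (mulPQ f u x) (Pplus w).
  apply: (etrans (inner_aer (L2_Pplus Lzw) LPw Lza (Pplus_shift Lw w0))).
  apply: (etrans (inner_ael Lza (L2_zpowM (-1) La) LPw (mulPQ_shift _ _ Lx x0))).
  exact: inner_zpowM.
have EQ : inner (mulPQ g v (shift x)) (Pminus (shift w)) =
    inner (mulPQ g v x) (Pminus w).
  apply: (etrans (inner_aer (L2_Pminus Lzw) LQw Lzb (Pminus_shift Lw w0))).
  apply: (etrans (inner_ael Lzb (L2_zpowM (-1) Lb) LQw (mulPQ_shift _ _ Lx x0))).
  exact: inner_zpowM.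
apply: (etrans (inner_GSIO Lf Lu Lg Lv Lzx Lzw)).
exact: (etrans (congr2 +%R EP EQ) (esym (inner_GSIO Lf Lu Lg Lv Lx Lw))).
Qed.

Definition L2_pair (p : (T -> C) * (T -> C)) := L2 p.1 /\ L2 p.2.

Lemma eq_tensor2P (p q p' q' : (T -> C) * (T -> C)) :
  L2_pair p -> L2_pair p' ->
  eq_L2L2op (tensor2 p q) (tensor2 p' q') <->
  forall x y : (T -> C) * (T -> C), L2_pair x -> L2_pair y ->
    inner2 x q * (inner2 y p)^* = inner2 x q' * (inner2 y p')^*.
Proof.
case: p p' => [p1 p2] [p1' p2'] [/= Lp1 Lp2] [/= Lp1' Lp2'].
rewrite /eq_L2L2op /tensor2 /=; split=> [H x [y1 y2] [Lx1 Lx2] [/= L1 L2y]|H x L1 L2x].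
  have [E1 E2] := H x Lx1 Lx2.
  move: (inner2 x q) (inner2 x q') E1 E2 => c c' E1 E2.
  rewrite /inner2 /= !conjcD !mulrDr -(innerC L1 Lp1) -(innerC L2y Lp2).
  rewrite -(innerC L1 Lp1') -(innerC L2y Lp2').
  congr (_ + _).
  - rewrite -(innerZl c Lp1 L1) -(innerZl c' Lp1' L1).
    exact: (inner_ael (L2Z c Lp1) (L2Z c' Lp1') L1 E1).
  - rewrite -(innerZl c Lp2 L2y) -(innerZl c' Lp2' L2y).
    exact: (inner_ael (L2Z c Lp2) (L2Z c' Lp2') L2y E2).
have L0 : L2 (fun=> 0 : C) := L2_cst 0.
have {}H (y : (T -> C) * (T -> C)) (Ly : L2_pair y) := H x y (conj L1 L2x) Ly.
move: (inner2 x q) (inner2 x q') H => c c' H.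
split.
- apply: (inner_ext (L2Z c Lp1) (L2Z c' Lp1')) => h Lh.
  have := H (h, fun=> 0) (conj Lh L0); rewrite /inner2 /=.
  rewrite (inner0l Lp2) (inner0l Lp2') !addr0 -(innerC Lh Lp1) -(innerC Lh Lp1').
  by rewrite (innerZl c Lp1 Lh) (innerZl c' Lp1' Lh).
- apply: (inner_ext (L2Z c Lp2) (L2Z c' Lp2')) => h Lh.
  have := H (fun=> 0, h) (conj L0 Lh); rewrite /inner2 /=.
  rewrite (inner0l Lp1) (inner0l Lp1') !add0r -(innerC Lh Lp2) -(innerC Lh Lp2').
  by rewrite (innerZl c Lp2 Lh) (innerZl c' Lp2' Lh).
Qed.

Section Symbols.
Variables f1 u1 g1 v1 f2 u2 g2 v2 : T -> C.
Hypotheses (Lf1 : Linfty f1) (Lu1 : Linfty u1) (Lg1 : Linfty g1) (Lv1 : Linfty v1).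
Hypotheses (Lf2 : Linfty f2) (Lu2 : Linfty u2) (Lg2 : Linfty g2) (Lv2 : Linfty v2).

Let LJf1 := LinftyJ Lf1.
Let LJu1 := LinftyJ Lu1.
Let LJg1 := LinftyJ Lg1.
Let LJv1 := LinftyJ Lv1.

Definition rank_one_identity := forall x1 x2 y1 y2,
  L2 x1 -> L2 x2 -> L2 y1 -> L2 y2 ->
  functional f2 u2 x1 x2 * (functional (conjf f1) (conjf g1) y1 y2)^* =
  functional g2 v2 x1 x2 * (functional (conjf u1) (conjf v1) y1 y2)^*.

(** The form of a single operator is invariant under the backward shift of both
    arguments ([inner_GSIO_shift]), so the two rank-one terms cancel. *)
Lemma GSIO_product_rank_one f3 u3 g3 v3 :
  [/\ Linfty f3, Linfty u3, Linfty g3 & Linfty v3] ->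
  eq_L2op (GSIO f1 u1 g1 v1 \o GSIO f2 u2 g2 v2) (GSIO f3 u3 g3 v3) ->
  rank_one_identity.
Proof.
move=> [Lf3 Lu3 Lg3 Lv3] E x1 x2 y1 y2 L1 L2x L3 L4.
have [LX _ _] := glue_parts L1 L2x; have [LY _ _] := glue_parts L3 L4.
have X0 := fourier_coef_glue L1 L2x; have Y0 := fourier_coef_glue L3 L4.
have form x w : L2 x -> L2 w -> product_form f1 u1 g1 v1 f2 u2 g2 v2 x w =
    inner (GSIO f3 u3 g3 v3 x) w.
  move=> Lx Lw.
  apply: (etrans (esym (inner_GSIO_comp Lf1 Lu1 Lg1 Lv1 Lf2 Lu2 Lg2 Lv2 Lx Lw))).
  apply: (inner_ael _ (L2_GSIO Lf3 Lu3 Lg3 Lv3 Lx) Lw (E x Lx)).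
  exact: (L2_GSIO Lf1 Lu1 Lg1 Lv1 (L2_GSIO Lf2 Lu2 Lg2 Lv2 Lx)).
have E1 := product_form_shift Lf1 Lu1 Lg1 Lv1 Lf2 Lu2 Lg2 Lv2 LX LY X0 Y0.
have E2 := etrans (form _ _ (L2_zpowM (-1) LX) (L2_zpowM (-1) LY))
  (inner_GSIO_shift Lf3 Lu3 Lg3 Lv3 LX LY X0 Y0).
have E3 := etrans (esym E1) (etrans E2 (esym (form _ _ LX LY))).
by move: E3 => /eqP; rewrite -addrA -subr_eq0 addrAC subrr add0r addrC subr_eq0 =>
  /eqP ->.
Qed.

Lemma tensor2_rank_one : rank_one_identity <-> eq_L2L2op
    (tensor2 (Vop (Pminus (conjf f1)), Pminus g1)
             (Vop (Pminus f2), Pminus (conjf u2)))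
    (tensor2 (Vop (Pminus (conjf u1)), Pminus v1)
             (Vop (Pminus g2), Pminus (conjf v2))).
Proof.
have vecL phi psi : Linfty phi -> Linfty psi -> L2_pair (symbol_vector phi psi).
  move=> Lphi Lpsi; split; first exact: (L2_Vop (L2_Pminus (Linfty_L2 Lphi))).
  exact: (L2_Pminus (Linfty_L2 (LinftyJ Lpsi))).
have E := eq_tensor2P (symbol_vector f2 u2) (symbol_vector g2 v2)
  (vecL _ _ LJf1 LJg1) (vecL _ _ LJu1 LJv1).
rewrite /symbol_vector !conjfK in E; apply: (iff_trans _ (iff_sym E)).
split=> [H [x1 x2] [y1 y2] [L1 L2x] [L3 L4]|H x1 x2 y1 y2 L1 L2x L3 L4].
  have := H x1 x2 y1 y2 L1 L2x L3 L4.
  rewrite -(inner2_symbol_vector Lf2 Lu2 L1 L2x) -(inner2_symbol_vector Lg2 Lv2 L1 L2x).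
  rewrite -(inner2_symbol_vector LJf1 LJg1 L3 L4) -(inner2_symbol_vector LJu1 LJv1 L3 L4).
  by rewrite /symbol_vector !conjfK.
rewrite -(inner2_symbol_vector Lf2 Lu2 L1 L2x) -(inner2_symbol_vector Lg2 Lv2 L1 L2x).
rewrite -(inner2_symbol_vector LJf1 LJg1 L3 L4) -(inner2_symbol_vector LJu1 LJv1 L3 L4).
by rewrite /symbol_vector !conjfK; apply: (H (x1, x2) (y1, y2)).
Qed.

(** Equality of two products of functionals: if one side vanishes, so does the
    other; otherwise the factors are proportional. *)
Lemma rank_one_dichotomy : rank_one_identity ->
  ((Hinfty_pair (conjf f1) (conjf g1) \/ Hinfty_pair f2 u2) /\
   (Hinfty_pair (conjf u1) (conjf v1) \/ Hinfty_pair g2 v2)) \/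
  exists lambda, [/\ lambda != 0,
    Hinfty_pair (conjf f1 \+ (fun z => - lambda^* * conjf u1 z))
                (conjf g1 \+ (fun z => - lambda^* * conjf v1 z)) &
    Hinfty_pair (g2 \+ (fun z => - lambda * f2 z))
                (v2 \+ (fun z => - lambda * u2 z))].
Proof.
move=> H.
have nz phi psi : Linfty phi -> Linfty psi -> ~ Hinfty_pair phi psi ->
    exists x1 x2, [/\ L2 x1, L2 x2 & functional phi psi x1 x2 != 0].
  move=> Lphi Lpsi nH; apply: contrapT => none; apply: nH.
  apply/(functional_eq0P Lphi Lpsi) => x1 x2 L1 L2x.
  by apply: contrapT => /eqP n0; apply: none; exists x1, x2.
have [A|A] := pselect (Hinfty_pair (conjf f1) (conjf g1) \/ Hinfty_pair f2 u2).
  left; split=> //; apply: contrapT => /not_orP[/(nz _ _ LJu1 LJv1)] .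
  move=> [y1 [y2 [L3 L4 ny]]] /(nz _ _ Lg2 Lv2)[x1 [x2 [L1 L2x nx]]].
  have := H x1 x2 y1 y2 L1 L2x L3 L4.
  have -> : functional f2 u2 x1 x2 * (functional (conjf f1) (conjf g1) y1 y2)^* = 0.
    case: A => [/(functional_eq0P LJf1 LJg1)->//|/(functional_eq0P Lf2 Lu2)->//].
      by rewrite conjC0 mulr0.
    by rewrite mul0r.
  move/esym/eqP; rewrite mulf_eq0 conjC_eq0 => /orP[h|h].
    exact: (negP nx h).
  exact: (negP ny h).
right; have /not_orP[nA nB] := A.
have [y1 [y2 [L3 L4 ky]]] := nz _ _ LJf1 LJg1 nA.
have [x1 [x2 [L1 L2x cx]]] := nz _ _ Lf2 Lu2 nB.
have E := H x1 x2 y1 y2 L1 L2x L3 L4.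
(* The ratio of the two functionals of [x]; fixing nonzero values of one side
   at a time gives both proportionalities. *)
pose lambda := functional g2 v2 x1 x2 / functional f2 u2 x1 x2.
have E' : functional g2 v2 x1 x2 = lambda * functional f2 u2 x1 x2.
  by rewrite /lambda divfK.
have kE s1 s2 : L2 s1 -> L2 s2 -> functional (conjf f1) (conjf g1) s1 s2 =
    lambda^* * functional (conjf u1) (conjf v1) s1 s2.
  move=> Ls1 Ls2; have := H x1 x2 s1 s2 L1 L2x Ls1 Ls2.
  rewrite E' [lambda * _]mulrC -mulrA => /(mulfI cx) /(congr1 (fun t => t^*)).
  by rewrite conjcM !conjCK.
have k'y : functional (conjf u1) (conjf v1) y1 y2 != 0.
  by apply: contra ky => /eqP k0; rewrite kE// k0 mulr0.
have l0 : lambda != 0.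
  by apply: contra ky => /eqP k0; rewrite kE// k0 conjC0 mul0r.
exists lambda; split; first exact: l0.
- apply/functional_eq0P; [exact: (LinftyD LJf1 (LinftyZ _ LJu1))|
    exact: (LinftyD LJg1 (LinftyZ _ LJv1))|].
  move=> s1 s2 Ls1 Ls2; rewrite functional_lin// kE//; ring.
- apply/functional_eq0P; [exact: (LinftyD Lg2 (LinftyZ _ Lf2))|
    exact: (LinftyD Lv2 (LinftyZ _ Lu2))|].
  move=> s1 s2 Ls1 Ls2; rewrite functional_lin//.
  have := H s1 s2 y1 y2 Ls1 Ls2 L3 L4; rewrite kE// conjcM conjCK mulrA.
  move/(mulIf _) => <-; last by rewrite conjC_eq0.
  ring.
Qed.

End Symbols.
End Main.

Theorem theorem3p1 (R : realType) (f1 u1 g1 v1 f2 u2 g2 v2 : circle R -> R[i])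
    (Hf1 : Linfty f1) (Hu1 : Linfty u1) (Hg1 : Linfty g1) (Hv1 : Linfty v1)
    (Hf2 : Linfty f2) (Hu2 : Linfty u2) (Hg2 : Linfty g2) (Hv2 : Linfty v2) :
  let S1 := exists f3 u3 g3 v3 : circle R -> R[i],
    [/\ Linfty f3, Linfty u3, Linfty g3 & Linfty v3] /\
    eq_L2op (GSIO f1 u1 g1 v1 \o GSIO f2 u2 g2 v2) (GSIO f3 u3 g3 v3) in
  let S2 := eq_L2L2op
    (tensor2 (Vop (Pminus (conjf f1)), Pminus g1)
             (Vop (Pminus f2), Pminus (conjf u2)))
    (tensor2 (Vop (Pminus (conjf u1)), Pminus v1)
             (Vop (Pminus g2), Pminus (conjf v2))) in
  let S31 :=
    (Hinfty (conjf f1) /\ Hinfty g1 \/ Hinfty f2 /\ Hinfty (conjf u2)) /\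
    (Hinfty (conjf u1) /\ Hinfty v1 \/ Hinfty g2 /\ Hinfty (conjf v2)) in
  let S32 := exists lambda : R[i], lambda != 0 /\
    [/\ Hinfty (fun z => (f1 z)^* - lambda^* * (u1 z)^*),
        Hinfty (fun z => g1 z - lambda * v1 z),
        Hinfty (fun z => g2 z - lambda * f2 z) &
        Hinfty (fun z => (v2 z)^* - lambda^* * (u2 z)^*)] in
  (S1 <-> S2) /\ (S2 <-> S31 \/ (~ S31 /\ S32)).
Proof.
move=> S1 S2 S31 S32.
have pairJ (f g : circle R -> R[i]) :
    Hinfty_pair (conjf f) (conjf g) <-> Hinfty (conjf f) /\ Hinfty g.
  by rewrite /Hinfty_pair conjfK.
have coupledE (lambda : R[i]) :
    (Hinfty_pair (conjf f1 \+ (fun z => - lambda^* * conjf u1 z))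
                 (conjf g1 \+ (fun z => - lambda^* * conjf v1 z)) /\
     Hinfty_pair (g2 \+ (fun z => - lambda * f2 z))
                 (v2 \+ (fun z => - lambda * u2 z))) <->
    [/\ Hinfty (fun z => (f1 z)^* - lambda^* * (u1 z)^*),
        Hinfty (fun z => g1 z - lambda * v1 z),
        Hinfty (fun z => g2 z - lambda * f2 z) &
        Hinfty (fun z => (v2 z)^* - lambda^* * (u2 z)^*)].
  have -> : conjf f1 \+ (fun z => - lambda^* * conjf u1 z) =
      (fun z => (f1 z)^* - lambda^* * (u1 z)^*).
    by apply/funext => z; rewrite /conjf /= mulNr.
  have -> : conjf g1 \+ (fun z => - lambda^* * conjf v1 z) =
      conjf (fun z => g1 z - lambda * v1 z).
    by apply/funext => z; rewrite /conjf /= conjcD conjcN conjcM mulNr.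
  have -> : g2 \+ (fun z => - lambda * f2 z) = (fun z => g2 z - lambda * f2 z).
    by apply/funext => z /=; rewrite mulNr.
  have -> : v2 \+ (fun z => - lambda * u2 z) =
      conjf (fun z => (v2 z)^* - lambda^* * (u2 z)^*).
    by apply/funext => z; rewrite /conjf /= conjcD conjcN conjcM !conjCK mulNr.
  by rewrite /Hinfty_pair !conjfK; split=> [[[? ?] [? ?]]|[? ? ? ?]].
have S12 : S1 -> S2.
  move=> [f3 [u3 [g3 [v3 [L3 E]]]]].
  apply/(tensor2_rank_one Hf1 Hu1 Hg1 Hv1 Hf2 Hu2 Hg2 Hv2).
  exact: (GSIO_product_rank_one Hf1 Hu1 Hg1 Hv1 Hf2 Hu2 Hg2 Hv2 L3 E).
have S23 : S2 -> S31 \/ S32.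
  move/(tensor2_rank_one Hf1 Hu1 Hg1 Hv1 Hf2 Hu2 Hg2 Hv2).
  move/(rank_one_dichotomy Hf1 Hu1 Hg1 Hv1 Hf2 Hu2 Hg2 Hv2).
  move=> [[AB CD]|[lambda [l0 H1 H2]]].
    left; split; first by case: AB => [/pairJ|]; [left|right].
    by case: CD => [/pairJ|]; [left|right].
  by right; exists lambda; split; [exact: l0|apply/coupledE; split].
have S31' : S31 \/ S32 -> S1.
  move=> S3; apply: (GSIO_of_form Hf1 Hu1 Hg1 Hv1 Hf2 Hu2 Hg2 Hv2).
  case: S3 => [[AB CD]|[lambda [_ /coupledE[H1 H2]]]].
    apply: (split_product_form Hf1 Hu1 Hg1 Hv1 Hf2 Hu2 Hg2 Hv2).
      by case: AB => [/pairJ|]; [left|right].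
    by case: CD => [/pairJ|]; [left|right].
  exact: (coupled_product_form Hf1 Hu1 Hg1 Hv1 Hf2 Hu2 Hg2 Hv2 H1 H2).
split; first by split=> [/S12//|/S23/S31'].
split=> [/S23[H|H]|[H|[_ H]]].
- by left.
- by have [H'|H'] := pselect S31; [left|right].
- by apply: S12; apply: S31'; left.
- by apply: S12; apply: S31'; right.
Qed.
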